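(* Let $n\ge 2$. The canonical prismatic flag diagrams form a complete invariant of Farey summation continued fractions: for two finite continued fractions $\alpha,\beta$ (extended Meester continued fractions of vectors in $\mathbb Z^n$) one has $\alpha=\beta$ if and only if $T(\alpha)=T(\beta)$, where $T(\cdot)$ denotes the canonical prismatic flag diagram. In addition, the combinatorics of $T(\alpha)$ coincides with the combinatorics of the Farey polyhedron of $\alpha$: there is a bijection between the vertices (marked points included) of $T(\alpha)$ and the vertices of the Farey simplices subdividing the Farey polyhedron of $\alpha$, sending the deck of $T(\alpha)$ to the deck of the Farey polyhedron with its enumeration, and inducing a dimension-preserving, order-preserving bijection between the simplices of $T(\alpha)$ and the Farey simplices, compatible with incidence of faces.
   Context: **Continued fractions (Meester algorithm).** Start with an $n$-tuple of non-negative integers. At step $i$ let $j\equiv i \bmod n$, $j\in\{1,\dots,n\}$. If the $j$-th coordinate is zero the step is skipped (no element is recorded). Otherwise subtract the $j$-th coordinate simultaneously from all other non-zero coordinates as many times as possible while all remain non-negative; the number of subtractions $a_i\ge 0$ is recorded. If a coordinate $j$ becomes zero, the symbol $|_j$ is written after the element at which this happened (several such symbols in a row are possible). The algorithm stops when one non-zero coordinate is left; the last symbol $|_j$ is not written. The resulting expression $$\alpha=[a_1;\cdots:a_{s_{j_1}}\,|_{j_1}\,a_{s_{j_1}+1}:\cdots:a_{s_{j_2}}\,|_{j_2}\cdots|_{j_{n-2}}\,a_{s_{j_{n-2}}+1}:\cdots:a_N]$$ is the Meester continued fraction. An extended Meester continued fraction is either a Meester continued fraction, or one obtained from it by replacing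 the last element $a_N$ by $(a_N-1,0,\dots,0,1)$, where the number of zeros is at most $k-2$ and $k$ is the number of non-zero coordinates at the last step. Each element is attached to an index in $\{1,\dots,n\}$: the first to $1$, each following one to the next index in cyclic order among those $j$ for which $|_j$ has not yet occurred (the active indices). **Farey polyhedron of $\alpha$ (nose stretching).** Start with $V_i=E_i$, the basis vectors of $\mathbb Z^n$. Process the elements in order: for an element $a$ attached to the index $c$, repeat $a$ times: replace $V_c$ by $V_c'=\sum_{i\text{ active}}V_i$ and record the Farey simplex whose vertices are the old $V_c$, the new $V_c'$ and all other active $V_i$. At a symbol $|_j$ the index $j$ becomes inactive. The Farey polyhedron is the union of all recorded Farey simplices, with this subdivision and order; its deck is the simplex $E_1\cdots E_n$. **Prismatic diagrams.** Let $\mathcal R^{k-1}$ be a simplex with enumerated vertices $R_1,\dots,R_k$, let $v\neq 0$ be orthogonal to its plane and $D=(d_1,\dots,d_k)$ be non-negative integers. The prismatic polyhedron is $\mathrm{conv}(R_1,\dots,R_k,R_1+d_1v,\dots,R_k+d_kv)$ with the points $R_i+tv$, $1\le t\le d_i-1$, marked. A triangulation uses as its vertices exactly all vertices and marked points; it is a path-triangulation if its dual graph (simplices as nodes, shared codimension 1 faces as edges) is a path. A prismatic diagram is an ordered path-triangulation of a prismatic polyhedron, running from the deck $F_0=(R_1,\dots,R_k)$ to the nest $F_1=(R_1+d_1v,\dots,R_k+d_kv)$, with vertices enumerated by the indices of the $R_i$. The $i$-th mast is the segment from $R_i$ to $R_i+d_iv$, divided into its mast edges. It is canonical if $R_i=E_i$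 $(i\le k)$ and $v=(1,\dots,1,0,\dots,0)$ ($k$ ones). Its LR-sequence $(M_1,\dots,M_m)$ lists the index $M_i$ of the mast that gets a new edge in the $i$-th simplex; it may be written in exponential form $1^{a_1}2^{a_2}\cdots k^{a_k}1^{a_{k+1}}\cdots$. The LR-sequence determines the canonical prismatic diagram. **Prismatic flag diagrams.** Given prismatic diagrams $T_1,\dots,T_l$ with numbers of masts $k_1>\dots>k_l$ and index sequences $S_1=(1,\dots,k_1)\supset S_2\supset\dots\supset S_l$ with $|S_i|=k_i$, the prismatic flag diagram $(T_i,S_i)_{i=1}^l$ is obtained by successive concatenation: at stage $i$ only the masts with indices in $S_i$ are continued, by the segments and the simplices of $T_i$, in the direction of the first vector $v$. It is canonical if $T_1$ is canonical. **The diagram $T(\alpha)$.** For $i=1,\dots,n-1$ let $T_i$ be the canonical prismatic diagram whose LR-sequence is given in exponential form by the elements $(a_{s_{j_{i-1}}+1},\dots,a_{s_{j_i}})$ of $\alpha$ between consecutive symbols $|$ (with $s_{j_0}=0$ and the last block ending at $a_N$; blocks may be empty), each element being the exponent of the index to which it is attached. Let $S_1=(1,\dots,n)$ and $S_i=S_{i-1}\setminus\{j_{i-1}\}$ for $i\ge2$, with induced ordering. Then $T(\alpha)=(T_i,S_i)_{i=1}^{n-1}$. *)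

(* Defs.v *)
From HB Require Import structures.
From mathcomp Require Import all_boot all_order all_algebra.
From mathcomp Require Import finmap.
Set Implicit Arguments.
Unset Strict Implicit.
Unset Printing Implicit Defensive.
Import Order.TTheory GRing.Theory Num.Theory.
Local Open Scope fset_scope.
Local Open Scope ring_scope.

(* All indices (coordinates, masts) are 0-based: {0, ..., n-1} stands for the
   {1, ..., n} of the text. *)

(** * Meester continued fractions *)

(* A continued fraction is the word formed by its elements a_i and its
   symbols |_j, from left to right. *)
Inductive cf_symbol : Type := Elt of nat | Bar of nat.

Section Meester.
Local Open Scope nat_scope.

Definition nonzeros (x : seq nat) : nat := count (fun y => y != 0) x.

(* The largest a such that the j-th coordinate can be subtracted a times from
   every other non-zero coordinate; the bound sumn x on the search range is
   harmless as soon as x_j and some other coordinate are non-zero. *)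
Definition subtractions (x : seq nat) (j : nat) : nat :=
  \max_(a < (sumn x).+1 |
          all (fun i => [|| i == j, nth 0 x i == 0
                          | a * nth 0 x j <= nth 0 x i]) (iota 0 (size x))) a.

(* Zero coordinates are left unchanged, because of truncated subtraction. *)
Definition subtract (x : seq nat) (j a : nat) : seq nat :=
  mkseq (fun i => if i == j then nth 0 x i else nth 0 x i - a * nth 0 x j)
        (size x).

(* Symbols produced at the same moment are written in increasing order of
   their indices. *)
Definition new_bars (x x' : seq nat) : seq cf_symbol :=
  [seq Bar i | i <- iota 0 (size x) & (nth 0 x i != 0) && (nth 0 x' i == 0)].

Record mstate := MState { m_count : nat; m_vec : seq nat; m_out : seq cf_symbol }.

(* A coordinate that is zero from the outset has its symbol |_j written in
   front of all elements. *)
Definition minit (x : seq nat) : mstate :=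
  MState 0 x [seq Bar i | i <- iota 0 (size x) & nth 0 x i == 0].

(* A state with at most one non-zero coordinate is final: it is a fixed point. *)
Definition mstep (st : mstate) : mstate :=
  let: MState i x out := st in
  let j := i %% size x in
  if nonzeros x <= 1 then st
  else if nth 0 x j == 0 then MState i.+1 x out
  else let a := subtractions x j in
       let x' := subtract x j a in
       MState i.+1 x' (out ++ Elt a :: new_bars x x').

(* The run writes a symbol for all but one of the n coordinates; the last
   symbol written is then erased. *)
Definition meester_cf (n : nat) (alpha : seq cf_symbol) : Prop :=
  exists (x : seq nat) (m : nat) (j : nat),
    let st := iter m mstep (minit x) in
    [/\ size x = n, nonzeros (m_vec st) = 1
      & m_out st = rcons alpha (Bar j)].

(* [st] is the state before the last step, so that [a] is the last element
   a_N; it may be followed by symbols. *)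
Definition extension_cf (n : nat) (alpha : seq cf_symbol) : Prop :=
  exists (x : seq nat) (m a z : nat) (bs : seq cf_symbol) (j : nat),
    let st := iter m mstep (minit x) in
    let k := nonzeros (m_vec st) in
    [/\ size x = n,
        1 < k /\ nonzeros (m_vec (mstep st)) = 1,
        m_out (mstep st) = m_out st ++ Elt a :: rcons bs (Bar j),
        z <= k - 2
      & alpha = m_out st ++ Elt a.-1 :: nseq z (Elt 0) ++ Elt 1 :: bs].

Definition extended_cf (n : nat) (alpha : seq cf_symbol) : Prop :=
  meester_cf n alpha \/ extension_cf n alpha.

(* The first index of the sequence q, q+1, ..., n-1, 0, ..., q-1 that belongs
   to the set A of active indices. *)
Definition next_active (n : nat) (A : seq nat) (q : nat) : nat :=
  head 0 [seq i <- rot q (iota 0 n) | i \in A].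

Definition deactivate (A : seq nat) (j : nat) : seq nat :=
  [seq i <- A | i != j].

(* The blocks of a continued fraction between consecutive symbols |_j. A block
   is given by its set of active indices and by the expansion of its
   exponential form c^a c'^a' ..., where c, c', ... are the indices to which
   the elements a, a', ... are attached. [q] is the place from which the next
   active index is searched and [w] is the part of the current block already
   read. *)
Fixpoint blocks (n : nat) (A : seq nat) (q : nat) (w : seq nat)
    (alpha : seq cf_symbol) : seq (seq nat * seq nat) :=
  match alpha with
  | [::] => [:: (A, w)]
  | Elt a :: alpha' =>
      let c := next_active n A q in blocks n A c.+1 (w ++ nseq a c) alpha'
  | Bar j :: alpha' => (A, w) :: blocks n (deactivate A j) q [::] alpha'
  end.

Definition cf_blocks (n : nat) (alpha : seq cf_symbol) :=
  blocks n (iota 0 n) 0 [::] alpha.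

End Meester.

(** * The Farey polyhedron *)

Section Farey.
Variable n : nat.

Definition unit_vec (K : pzRingType) (i : nat) : 'rV[K]_n :=
  \row_(l < n) (l == i :> nat)%:R.

Definition new_vertex (A : seq nat) (V : nat -> 'rV[int]_n) : 'rV[int]_n :=
  \sum_(i <- A) V i.

Definition replace_vertex (A : seq nat) (c : nat) (V : nat -> 'rV[int]_n) :=
  fun i => if i == c then new_vertex A V else V i.

(* The Farey simplices, given by their vertex sets, that are recorded while
   V_c is replaced a times. *)
Fixpoint stretch (A : seq nat) (c a : nat) (V : nat -> 'rV[int]_n) :
    seq {fset 'rV[int]_n} :=
  if a is a'.+1
  then ([fset V i | i in A] `|` [fset new_vertex A V])
         :: stretch A c a' (replace_vertex A c V)
  else [::].

Fixpoint farey (A : seq nat) (q : nat) (V : nat -> 'rV[int]_n)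
    (alpha : seq cf_symbol) : seq {fset 'rV[int]_n} :=
  match alpha with
  | [::] => [::]
  | Elt a :: alpha' =>
      let c := next_active n A q in
      stretch A c a V ++ farey A c.+1 (iter a (replace_vertex A c) V) alpha'
  | Bar j :: alpha' => farey (deactivate A j) q V alpha'
  end.

Definition farey_simplices (alpha : seq cf_symbol) : seq {fset 'rV[int]_n} :=
  farey (iota 0 n) 0 (unit_vec int) alpha.

(* The deck is part of the Farey polyhedron. Its vertices already belong to the
   first Farey simplex when no symbol |_j precedes the first positive element. *)
Definition farey_vertex (alpha : seq cf_symbol) (x : 'rV[int]_n) : Prop :=
  (exists2 i, (i < n)%N & x = unit_vec int i)
  \/ (exists2 s, s \in farey_simplices alpha & x \in s).

End Farey.

(** * Prismatic diagrams *)

Section Geometry.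
Variables (R : realFieldType) (N : nat).

Definition conv (s : seq 'rV[R]_N) (x : 'rV[R]_N) : Prop :=
  exists w : 'rV[R]_N -> R,
    [/\ forall y, y \in s -> 0 <= w y, \sum_(y <- s) w y = 1
      & x = \sum_(y <- s) w y *: y].

Definition differences (s : seq 'rV[R]_N) : seq 'rV[R]_N :=
  [seq x - head 0 s | x <- behead s].

Definition aff_indep (s : seq 'rV[R]_N) : bool := free (differences s).

Definition aff_dim (s : seq 'rV[R]_N) : nat := \dim <<differences s>>%VS.

(* The pair (i, t) stands for the vertex or marked point R_i + t v, that is, the
   t-th point of the i-th mast; simplices are given by their sets of vertices,
   in the given order. *)
Record prism := Prism {
  base : seq 'rV[R]_N;
  dir : 'rV[R]_N;
  heights : seq nat;
  simps : seq {fset nat * nat}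
}.

Definition point (D : prism) (l : nat * nat) : 'rV[R]_N :=
  nth 0 (base D) l.1 + l.2%:R *: dir D.

Definition points (D : prism) (s : {fset nat * nat}) : seq 'rV[R]_N :=
  [seq point D l | l <- enum_fset s].

Definition deck (D : prism) : seq (nat * nat) :=
  [seq (i, 0%N) | i <- iota 0 (size (base D))].

Definition nest (D : prism) : seq (nat * nat) :=
  [seq (i, nth 0%N (heights D) i) | i <- iota 0 (size (base D))].

Definition polyhedron (D : prism) : 'rV[R]_N -> Prop :=
  conv [seq point D l | l <- deck D ++ nest D].

Definition on_mast (D : prism) (l : nat * nat) : bool :=
  (l.1 < size (base D))%N && (l.2 <= nth 0%N (heights D) l.1)%N.

Definition prism_data (D : prism) : Prop :=
  [/\ (0 < size (base D))%N,
      size (heights D) = size (base D),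
      aff_indep (base D),
      dir D != 0
    & forall x y, x \in base D -> y \in base D -> (x - y) *m (dir D)^T = 0].

Definition triangulation (D : prism) : Prop :=
  [/\ forall s, s \in simps D ->
        #|` s| = (size (base D)).+1 /\ aff_indep (points D s),
      forall l, on_mast D l <-> (exists2 s, s \in simps D & l \in s),
      forall x, polyhedron D x <->
        (exists2 s, s \in simps D & conv (points D s) x),
      forall s s' x, s \in simps D -> s' \in simps D ->
        conv (points D s) x -> conv (points D s') x ->
        conv (points D (s `&` s')) x
    & uniq (simps D)].

(* The dual graph is a path, and the simplices are listed along this path. *)
Definition dual_path (D : prism) : Prop :=
  forall p q, (p < q < size (simps D))%N ->
    #|` nth fset0 (simps D) p `&` nth fset0 (simps D) q| = size (base D)
    <-> q = p.+1.

Definition deck_to_nest (D : prism) : Prop :=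
  {subset deck D <= head fset0 (simps D)} /\
  {subset nest D <= last fset0 (simps D)}.

(* If all d_i are zero the polyhedron degenerates to its deck, and the diagram
   has no simplex (and hence an empty LR-sequence). *)
Definition prismatic_diagram (D : prism) : Prop :=
  prism_data D /\
  if all (fun d => d == 0%N) (heights D) then simps D = [::]
  else [/\ triangulation D, dual_path D & deck_to_nest D].

Definition canonical (D : prism) : Prop :=
  [/\ (size (base D) <= N)%N,
      base D = [seq unit_vec N R i | i <- iota 0 (size (base D))]
    & dir D = \row_(l < N) (l < size (base D))%N%:R].

(* The p-th simplex contains a mast edge of the mast w_p. *)
Definition LR_sequence (D : prism) (w : seq nat) : Prop :=
  size w = size (simps D) /\
  forall p, (p < size w)%N ->
    exists t, (nth 0%N w p, t) \in nth fset0 (simps D) p /\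
              (nth 0%N w p, t.+1) \in nth fset0 (simps D) p.

(** * Prismatic flag diagrams *)

Definition flag := seq (prism * seq nat).

Definition stage (F : flag) (p : nat) : prism * seq nat :=
  nth (Prism [::] 0 [::] [::], [::]) F p.

Definition first_prism (F : flag) : prism := (stage F 0).1.

Definition flag_diagram (F : flag) : Prop :=
  [/\ F <> [::],
      forall p, (p < size F)%N -> let: (T, Sp) := stage F p in
        prismatic_diagram T /\ size Sp = size (base T),
      (stage F 0).2 = iota 0 (size (base (first_prism F)))
    & sorted (fun S S' => subseq S' S && (size S' < size S)%N)
        [seq TS.2 | TS <- F]].

Definition canonical_flag_diagram (F : flag) : Prop :=
  flag_diagram F /\ canonical (first_prism F).

(* Concatenation: the mast p of the diagram T with index sequence S continues
   the mast S_p from the height H(S_p) that it has already reached. *)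
Definition shift_label (S : seq nat) (H : nat -> nat) (l : nat * nat) :=
  (nth 0%N S l.1, (H (nth 0%N S l.1) + l.2)%N).

Definition raise (S : seq nat) (d : seq nat) (H : nat -> nat) (i : nat) : nat :=
  if i \in S then (H i + nth 0%N d (index i S))%N else H i.

Fixpoint concat_labels (F : flag) (H : nat -> nat) : seq {fset nat * nat} :=
  if F is (T, Sp) :: F'
  then [seq shift_label Sp H @` s | s <- simps T]
         ++ concat_labels F' (raise Sp (heights T) H)
  else [::].

Definition mast_height (F : flag) : nat -> nat :=
  foldl (fun H TS => raise TS.2 (heights TS.1) H) (fun=> 0%N) F.

Definition flag_vertex (F : flag) (x : 'rV[R]_N) : Prop :=
  exists i t, [/\ (i < size (base (first_prism F)))%N, (t <= mast_height F i)%N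
                & x = point (first_prism F) (i, t)].

Definition flag_simplices (F : flag) : seq {fset 'rV[R]_N} :=
  [seq point (first_prism F) @` s | s <- concat_labels F (fun=> 0%N)].

End Geometry.

(** * The diagram T(alpha) *)

Definition is_T (R : realFieldType) (n : nat) (alpha : seq cf_symbol)
    (F : flag R n) : Prop :=
  [seq TS.2 | TS <- F] = [seq b.1 | b <- cf_blocks n alpha] /\
  forall p, (p < size F)%N ->
    let: (T, Sp) := stage F p in
    let w := (nth ([::], [::]) (cf_blocks n alpha) p).2 in
    [/\ prismatic_diagram T, canonical T, size (base T) = size Sp
      & LR_sequence T [seq index c Sp | c <- w]].

(* The first condition says that f is a bijection between the two sets of
   vertices, the second that it preserves the enumerated deck. The third
   identifies the p-th simplex of the flag diagram with the p-th Farey simplex,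
   for every p. The last two concern all faces of these simplices. *)
Definition same_combinatorics (R : realFieldType) (n : nat) (F : flag R n)
    (alpha : seq cf_symbol) : Prop :=
  exists f : 'rV[R]_n -> 'rV[int]_n,
    [/\ (forall x y, flag_vertex F x -> flag_vertex F y -> f x = f y -> x = y)
        /\ (forall z, farey_vertex alpha z <->
                      exists2 x, flag_vertex F x & f x = z),
        forall i, (i < n)%N -> f (unit_vec n R i) = unit_vec n int i,
        [seq f @` s | s <- flag_simplices F] = farey_simplices n alpha,
        forall (s A : {fset 'rV[R]_n}), s \in flag_simplices F -> A `<=` s ->
          aff_dim (enum_fset A) =
          aff_dim [seq map_mx intr y : 'rV[R]_n | y <- enum_fset (f @` A)]
      & forall (p : nat) (A : {fset 'rV[R]_n}),
          (forall x, x \in A -> flag_vertex F x) ->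
          (A `<=` nth fset0 (flag_simplices F) p) =
          (f @` A `<=` nth fset0 (farey_simplices n alpha) p)].

(* Main.v *)
Require Import Defs.
From mathcomp Require Import all_boot all_order all_algebra.
From mathcomp Require Import finmap zify ring lra.
Set Implicit Arguments.
Unset Strict Implicit.
Unset Printing Implicit Defensive.
Import Order.TTheory GRing.Theory Num.Theory.

(** A continued fraction is equivalent to the list of its blocks: the set of
    active indices, and the word in these indices obtained by expanding the
    exponential form. A prismatic diagram is equivalent to its LR-sequence. Both
    the diagram T(alpha) and the Farey polyhedron are then built from the same
    list of moves, where a move raises one active index by one step.

    Recovering alpha from its blocks. The expanded words lose the zero elements,
    and two elements attached to the same index may merge if only zeros lie
    between them. This happens only if the zeros make a full turn of the active
    indices. In a run of the algorithm they do not: they stop at the next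
    smallest entry, which can always be subtracted, and after a maximal
    subtraction without a new symbol the index just used does not carry a
    smallest entry. The reader [reads] expresses this bound on the zeros,
    [extended_readable] proves it for all extended continued fractions, and
    [cf_blocks_inj] decodes the blocks.

    Diagrams and LR-sequences. Over a point of the deck with barycentric
    coordinates beta, the simplex that raises the mast c above the heights h is
    the interval from h.beta to h.beta + beta_c. Stacking these intervals in the
    order of a word w gives an increasing chain that fills the prism; this
    proves that the staircase [stair] is a path-triangulation
    ([stair_prismatic]). Conversely, a full-dimensional simplex has one vertex
    on each mast and one more on the mast prescribed by the LR-sequence. The
    first simplex stands on the deck. Two consecutive ones share a facet; if the
    second one were not put on the top of the first one, then some interior
    point of a simplex would lie in another simplex, which is impossible in a
    triangulation ([slab_overlap]). So the diagram is the staircase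
    ([LR_determines]). Therefore T(alpha) is the explicit flag [stair_flag], and
    it determines the blocks, hence alpha.

    Comparison with the Farey polyhedron. The t-th point of the i-th mast is sent
    to the t-th vertex V_i. A simplex of the flag and the Farey simplex at the
    same place then have the same labels. It remains to see that the vertices
    V_i are distinct for distinct labels. The active ones always belong to a
    lattice basis, a new vertex lies in their cone, and a vertex that is
    replaced or becomes inactive is separated from the cone of the remaining
    ones by a linear functional ([stretched_step], [stretched_sub]). The
    simplices on both sides are non-degenerate, so the dimension of each face is
    the number of its vertices minus one. *)

(** * Decoding a continued fraction from its blocks *)

(** The active indices in the cyclic order in which they are visited from the
    place [q] on; its head is [next_active n A q]. *)
Definition cyclic_order (n : nat) (A : seq nat) (q : nat) : seq nat :=
  [seq i <- rot q (iota 0 n) | i \in A].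

(** A reader that follows the runs of zero elements. The state consists of the
    active indices [A], the number [z] of zeros just read, and [d], which is 1
    if a positive element of the current block precedes these zeros and 0
    otherwise. The reader fails as soon as the zeros could bring it back to the
    index of that positive element, or let it skip every index at the beginning
    of a block; it also fails on a symbol |_j if a zero precedes it or [j] is not
    active. *)
Fixpoint reads (A : seq nat) (z d : nat) (alpha : seq cf_symbol) :
    option (seq nat * nat * nat) :=
  match alpha with
  | [::] => Some (A, z, d)
  | Elt a :: alpha' =>
      if z + d + (a == 0) < size A
      then if a == 0 then reads A z.+1 d alpha' else reads A 0 1 alpha'
      else None
  | Bar j :: alpha' =>
      if (z == 0) && (j \in A) then reads (deactivate A j) 0 0 alpha' else None
  end.

Definition readable (n : nat) (alpha : seq cf_symbol) : Prop :=
  exists A d, reads (iota 0 n) 0 0 alpha = Some (A, 0, d) /\ size A = 2.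

(** [blocks] accumulates the letters of the current block; this is the part that
    is still to come, so that two runs with a common past can be compared. *)
Fixpoint first_word (n : nat) (A : seq nat) (q : nat) (alpha : seq cf_symbol) :=
  if alpha is Elt a :: alpha' then
    nseq a (next_active n A q) ++ first_word n A (next_active n A q).+1 alpha'
  else [::].

Definition is_bar (s : cf_symbol) : bool := if s is Bar _ then true else false.

Lemma reads_cat A z d s t :
  reads A z d (s ++ t) =
  if reads A z d s is Some (A', z', d') then reads A' z' d' t else None.
Proof.
elim: s A z d => [|[a|j] s IH] A z d //=; last by case: ifP => // _; exact: IH.
by case: ifP => // _; case: ifP => _; exact: IH.
Qed.

Lemma deactivate_uniq (A : seq nat) j : uniq A -> uniq (deactivate A j).
Proof. exact: filter_uniq. Qed.

Lemma deactivate_sub (A : seq nat) j : {subset deactivate A j <= A}.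
Proof. by move=> i; rewrite mem_filter => /andP[]. Qed.

Lemma size_deactivate (A : seq nat) j : uniq A -> j \in A ->
  (size (deactivate A j)).+1 = size A.
Proof.
move=> uA jA; rewrite /deactivate size_filter -(count_predC (pred1 j) A).
by rewrite count_uniq_mem // jA.
Qed.

Lemma cyclic_order_perm n (A : seq nat) q :
  uniq A -> {subset A <= iota 0 n} -> perm_eq (cyclic_order n A q) A.
Proof.
move=> uA sA; apply: uniq_perm => //.
  by rewrite filter_uniq // rot_uniq iota_uniq.
move=> i; rewrite mem_filter mem_rot; case iA: (i \in A) => //=; exact: sA.
Qed.

Lemma mem_next_active n (A : seq nat) q : uniq A -> {subset A <= iota 0 n} -> 0 < size A ->
  next_active n A q \in A.
Proof.
move=> uA sA; have pA := cyclic_order_perm q uA sA.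
rewrite -(perm_size pA) -(perm_mem pA) /next_active -/(cyclic_order n A q).
by case: (cyclic_order n A q) => //= c L _; rewrite mem_head.
Qed.

(** The search for the next index resumes just behind the index found, so the
    active indices turn by one place. *)
Lemma cyclic_order_next n A q c L :
  cyclic_order n A q = c :: L -> cyclic_order n A c.+1 = rcons L c.
Proof.
move=> E; have cA : c \in A.
  have : c \in cyclic_order n A q by rewrite E mem_head.
  by rewrite mem_filter => /andP[].
have [s1 [s2 [Er f1 f2]]] : exists s1 s2, [/\ rot q (iota 0 n) = s1 ++ c :: s2,
    [seq i <- s1 | i \in A] = [::] & [seq i <- s2 | i \in A] = L].
  move: E; rewrite /cyclic_order; elim: (rot q _) => //= x s IH.
  case: ifP => [_ [-> <-]|xA /IH[s1 [s2 [-> f1 f2]]]]; first by exists [::], s.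
  by exists (x :: s1), s2; rewrite /= xA.
have [m mn Em] : exists2 m, m <= n & rot m (iota 0 n) = s2 ++ s1 ++ [:: c].
  have Es : rot (size s1).+1 (rot q (iota 0 n)) = s2 ++ s1 ++ [:: c].
    rewrite Er -cat_rcons.
    by rewrite -(size_rcons s1 c) rot_size_cat -cats1.
  case: (leqP q n) => qn; last first.
    have Eq : rot q (iota 0 n) = iota 0 n.
      by rewrite rot_oversize // size_iota ltnW.
    rewrite Eq in Es Er; exists (size s1).+1 => //.
    have := congr1 size Er; rewrite size_iota size_cat /=; lia.
  move: Es; rewrite rot_add_mod ?size_iota //; last first.
    have := congr1 size Er; rewrite size_rot size_iota size_cat /=; lia.
  move=> <-; eexists; last by [].
  have := congr1 size Er; rewrite size_rot size_iota size_cat /=.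
  by case: ifP; lia.
have cn : c < n.
  have : c \in iota 0 n by rewrite -(mem_rot q) Er mem_cat mem_head orbT.
  by rewrite mem_iota.
have Ec : rot c.+1 (iota 0 n) = s2 ++ s1 ++ [:: c].
  rewrite -Em; case: m mn Em => [_|m mn] Em.
    rewrite rot0 in Em *; have := congr1 (last 0) Em.
    rewrite !last_cat /= => El.
    have -> : c.+1 = n.
      have := last_rcons 0 (iota 0 n.-1) n.-1; rewrite -cats1 -(iotaD 0 n.-1 1).
      by rewrite addn1 prednK ?El; lia.
    by rewrite -{1}(size_iota 0 n) rot_size.
  suff -> : m = c by [].
  have := congr1 (last 0) Em; rewrite /rot !last_cat /= => <-.
  by rewrite (take_nth 0) ?size_iota // last_rcons nth_iota.
rewrite /cyclic_order Ec !filter_cat f1 f2 /= cA.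
by rewrite cats1.
Qed.

Lemma next_active_cyclic_order n (A : seq nat) q :
  uniq A -> {subset A <= iota 0 n} -> 0 < size A ->
  exists2 L, cyclic_order n A q = next_active n A q :: L & size L = (size A).-1.
Proof.
move=> uA sA; rewrite -(perm_size (cyclic_order_perm q uA sA)) /next_active -/(cyclic_order n A q).
by case: (cyclic_order n A q) => //= c L _; exists L.
Qed.

Lemma size_reads (A : seq nat) z d alpha A' z' d' : uniq A ->
  reads A z d alpha = Some (A', z', d') ->
  uniq A' /\ size A = size A' + count is_bar alpha.
Proof.
elim: alpha A z d => [|[a|j] alpha IH] A z d uA /=.
- by case=> <- _ _; rewrite addn0.
- by case: ifP => // _; rewrite add0n; case: ifP => _; apply: IH.
- case: ifP => // /andP[_ jA] /IH[|uA' E]; first exact: deactivate_uniq.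
  by split=> //; rewrite -(size_deactivate uA jA) E; lia.
Qed.

Lemma blocks_first n A q w alpha :
  blocks n A q w alpha =
  (A, w ++ first_word n A q alpha) :: behead (blocks n A q [::] alpha).
Proof.
elim: alpha q w => [|[a|j] alpha IH] q w /=; rewrite ?cats0 //.
by rewrite IH [in RHS]IH /= -catA.
Qed.

(** Zeros at the end of a block are excluded, since no zero may be pending at
    a symbol or at the end of the word. *)
Lemma first_word_pending n A q z d alpha A' d' : 0 < z ->
  reads A z d alpha = Some (A', 0, d') -> first_word n A q alpha != [::].
Proof.
elim: alpha A q z d => [|[a|j] alpha IH] A q z d z0 /=.
- by case=> _ z00; rewrite z00 in z0.
- case: ifP => // _; case: a => [|a] //=; exact: IH.
- by rewrite eqn0Ngt z0.
Qed.

(** The zeros that the reader still accepts are too few to reach the index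
    [c]. *)
Lemma first_word_avoids n (A : seq nat) q z d (c : nat) alpha st x u :
  uniq A -> {subset A <= iota 0 n} -> c \in A ->
  z + d < size A -> size A <= index c (cyclic_order n A q) + z + d ->
  reads A z d alpha = Some st -> first_word n A q alpha = x :: u -> x != c.
Proof.
move=> uA sA cA; elim: alpha q z d => [|[a|j] alpha IH] q z d lt le //=.
case: ifP => // az.
have A0 : 0 < size A by lia.
have [L EL sL] := next_active_cyclic_order q uA sA A0.
move: le; rewrite EL /=; case: eqP => [->|ne] le; first by lia.
case: a az => [|a] /= az; last by move=> _ [<- _]; apply/eqP.
have cL : c \in L.
  have := cA; rewrite -(perm_mem (cyclic_order_perm q uA sA)) EL inE.
  by case/orP=> // /eqP ec; case: ne.
apply: IH; first by rewrite addSn; move: az; rewrite addn1.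
by rewrite (cyclic_order_next EL) -cats1 index_cat cL; lia.
Qed.

Lemma deactivate_inj (A : seq nat) i j :
  i \in A -> deactivate A i = deactivate A j -> i = j.
Proof.
move=> iA E; apply/eqP; apply: contraT => ne.
have : i \in deactivate A j by rewrite mem_filter ne.
by rewrite -E mem_filter eqxx.
Qed.

(** The expanded words forget the zeros, and they do not separate two
    consecutive elements attached to the same index. Both are recovered since
    the reader never returns to the index it has just left: the number of equal
    letters is the element, and the number of indices skipped before the next
    letter is the number of zeros. *)
Lemma blocks_inj n alpha beta (A : seq nat) q z d w A1 d1 A2 d2 :
  uniq A -> {subset A <= iota 0 n} -> 1 < size A1 -> 1 < size A2 ->
  reads A z d alpha = Some (A1, 0, d1) -> reads A z d beta = Some (A2, 0, d2) ->
  blocks n A q w alpha = blocks n A q w beta -> alpha = beta.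
Proof.
elim: alpha beta A q z d w => [|s alpha IH] beta A q z d w uA sA sA1 sA2.
  case=> _ z0 _; subst z; case: beta => // -[b|j] beta /=.
    case: ifP => // lt; have A0 : 0 < size A by lia.
    rewrite blocks_first; case: b lt => [|b] lt /=.
      move/(first_word_pending n (next_active n A q).+1 (ltn0Sn 0)) => ne.
      case=> /(congr1 size); rewrite cats0 size_cat.
      by case: (first_word _ _ _ _) ne => //= x u _; lia.
    by move=> _ [] /(congr1 size); rewrite !size_cat /=; lia.
  by rewrite blocks_first; case: ifP => // _ _ [].
(* an element shorter than its counterpart would be followed by the same index *)
have short q' a b al be z' d' st : a < b -> z' + d' < size A ->
    (if a == 0 then 0 < z' else d' == 1) ->
    reads A z' d' al = Some st ->
    blocks n A (next_active n A q').+1 (w ++ nseq a (next_active n A q')) al =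
    blocks n A (next_active n A q').+1 (w ++ nseq b (next_active n A q')) be ->
    False.
  move=> ab zd0 zd R; rewrite [LHS]blocks_first [RHS]blocks_first => -[+ _].
  have A0 : 0 < size A by lia.
  set c := next_active n A q'; rewrite -!catA => /eqP; rewrite eqseq_cat //.
  case/andP=> _; rewrite -[b](subnK (ltnW ab)) addnC nseqD -catA.
  rewrite eqseq_cat // => /andP[_]; have : 0 < b - a by lia.
  case: (b - a) => // m _ /= /eqP E.
  have cA : c \in A by apply: mem_next_active.
  have [L EL sL] := next_active_cyclic_order q' uA sA A0; rewrite -/c in EL.
  have cL : c \notin L.
    have := perm_uniq (cyclic_order_perm q' uA sA); rewrite EL uA /=.
    by case/andP.
  have := first_word_avoids uA sA cA zd0 _ R E; rewrite eqxx => H.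
  suff: false by [].
  apply: H; rewrite (cyclic_order_next EL) -cats1 index_cat (negbTE cL) /= eqxx.
  by case: (a == 0) zd => [|/eqP ->]; lia.
case: beta => [|t beta].
  move=> + [_ z0 _]; subst z; case: s => [a|j] /=.
    case: ifP => // lt; have A0 : 0 < size A by lia.
    rewrite blocks_first; case: a lt => [|a] lt /=.
      move/(first_word_pending n (next_active n A q).+1 (ltn0Sn 0)) => ne.
      case=> /(congr1 size); rewrite cats0 size_cat.
      by case: (first_word _ _ _ _) ne => //= x u _; lia.
    by move=> _ [] /(congr1 size); rewrite !size_cat /=; lia.
  by rewrite [in X in _ -> X]blocks_first; case: ifP => // _ _ [].
case: s t => [a|i] [b|j] /=.
- case: ifP => // za Ra; case: ifP => // zb Rb.
  have sA' : 1 < size A.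
    by move: Ra; case: ifP => _ /(size_reads uA)[_]; lia.
  set c := next_active n A q => E.
  case: (ltngtP a b) => [ab|ba|ab].
  + exfalso; case: a ab za Ra E => [|a] ab za /= Ra E.
      by apply: (short q 0 b alpha beta z.+1 d _ _ _ _ Ra E) => //; lia.
    by apply: (short q a.+1 b alpha beta 0 1 _ _ _ _ Ra E) => //; lia.
  + exfalso; case: b ba zb Rb E => [|b] ba zb /= Rb E.
      by apply: (short q 0 a beta alpha z.+1 d _ _ _ _ Rb (esym E)) => //; lia.
    by apply: (short q b.+1 a beta alpha 0 1 _ _ _ _ Rb (esym E)) => //; lia.
  + subst b; congr (_ :: _); move: Ra Rb E.
    by case: ifP => _ Ra Rb; apply: IH Ra Rb.
- case: ifP => // za Ra; case: ifP => // /andP[/eqP z0 _] _; subst z.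
  rewrite blocks_first => -[+ _].
  case: a za Ra => [|a] za /=.
    move/(first_word_pending n (next_active n A q).+1 (ltn0Sn 0)) => ne.
    move/(congr1 size); rewrite cats0 size_cat.
    by case: (first_word _ _ _ _) ne => //= x u _; lia.
  by move=> _ /(congr1 size); rewrite !size_cat /=; lia.
- case: ifP => // /andP[/eqP z0 _] _; case: ifP => // za Rb; subst z.
  rewrite [in X in _ = X -> _]blocks_first => -[+ _].
  case: b za Rb => [|b] za /=.
    move/(first_word_pending n (next_active n A q).+1 (ltn0Sn 0)) => ne.
    move/(congr1 size); rewrite cats0 size_cat.
    by case: (first_word _ _ _ _) ne => //= x u _; lia.
  by move=> _ /(congr1 size); rewrite !size_cat /=; lia.
- case: ifP => // /andP[_ iA] Ra; case: ifP => // /andP[_ jA] Rb [E].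
  have ij : i = j.
    by apply: (@deactivate_inj A) => //; move: E; rewrite blocks_first
      [in RHS]blocks_first; case.
  subst j; congr (_ :: _); apply: IH Ra Rb E => //; first exact: deactivate_uniq.
  by move=> k /deactivate_sub /sA.
Qed.

(** With a single active index the sum of the active vertices would be the vertex
    that it replaces, so two of them are required. *)
Definition proper_block (n : nat) (b : seq nat * seq nat) : Prop :=
  [/\ uniq b.1, 1 < size b.1, {subset b.1 <= iota 0 n} & {subset b.2 <= b.1}].

Lemma blocks_spec n alpha (A : seq nat) q z d w A' z' d' :
  uniq A -> {subset A <= iota 0 n} -> 1 < size A' -> {subset w <= A} ->
  reads A z d alpha = Some (A', z', d') ->
  [/\ size (blocks n A q w alpha) = (count is_bar alpha).+1,
      forall b, b \in blocks n A q w alpha -> proper_block n b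
    & sorted (fun S S' => subseq S' S && (size S' < size S))
             [seq b.1 | b <- blocks n A q w alpha]].
Proof.
elim: alpha A q z d w => [|[a|j] alpha IH] A q z d w uA sA lt1 sw /=.
- by case=> EA _ _; subst A'; split=> // b; rewrite inE => /eqP ->.
- case: ifP => // lt; have A0 : 0 < size A by lia.
  set w' := w ++ _; have sw' : {subset w' <= A}.
    move=> i; rewrite mem_cat => /orP[/sw //|]; rewrite mem_nseq => /andP[_ /eqP ->].
    exact: mem_next_active.
  by rewrite add0n; case: ifP => _ R; apply: IH R.
- case: ifP => // /andP[_ jA] R; have sD := size_deactivate uA jA.
  have [||s1 s2 s3] // := IH _ q _ _ [::] (deactivate_uniq j uA) _ lt1 _ R.
    by move=> i /deactivate_sub /sA.
  have [_ lt2] := size_reads (deactivate_uniq j uA) R.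
  split; first by rewrite s1.
    move=> b; rewrite inE => /orP[/eqP ->|/s2 //]; split=> //=; lia.
  by move: s3; rewrite blocks_first /= => ->; rewrite filter_subseq -sD ltnS leqnn.
Qed.

Lemma readable_blocks n alpha : readable n alpha ->
  [/\ size (cf_blocks n alpha) = n.-1,
      exists w bs, cf_blocks n alpha = (iota 0 n, w) :: bs,
      forall b, b \in cf_blocks n alpha -> proper_block n b
    & sorted (fun S S' => subseq S' S && (size S' < size S))
             [seq b.1 | b <- cf_blocks n alpha]].
Proof.
move=> [A [d [R sA]]]; have uI := iota_uniq 0 n.
have [|||s1 s2 s3] := @blocks_spec n alpha (iota 0 n) 0 0 0 [::] A 0 d uI _ _ _ R => //.
  by rewrite sA.
have [_] := size_reads uI R; rewrite size_iota => En.
split=> //; first by rewrite s1 En sA; lia.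
by rewrite /cf_blocks blocks_first; eexists; eexists.
Qed.

Lemma cf_blocks_inj n alpha beta : readable n alpha -> readable n beta ->
  cf_blocks n alpha = cf_blocks n beta -> alpha = beta.
Proof.
move=> [A1 [d1 [R1 s1]]] [A2 [d2 [R2 s2]]] E.
apply: blocks_inj (iota_uniq 0 n) _ _ _ R1 R2 E; rewrite ?s1 ?s2 //.
Qed.

(** * Runs of the algorithm are decodable *)

Definition nonzero_idx (x : seq nat) : seq nat :=
  [seq l <- iota 0 (size x) | nth 0 x l != 0].

(** While another entry is non-zero, a step at [c] records a positive element
    exactly when [c] is lowest. *)
Definition lowest (x : seq nat) (c : nat) : bool :=
  (nth 0 x c != 0) &&
  all (fun l => (nth 0 x l == 0) || (nth 0 x c <= nth 0 x l)) (iota 0 (size x)).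

Lemma nonzerosE x : nonzeros x = size (nonzero_idx x).
Proof.
rewrite /nonzeros /nonzero_idx -{1}[x](mkseq_nth 0) /mkseq count_map size_filter.
by apply: eq_count.
Qed.

Lemma mem_nonzero_idx x l : (l \in nonzero_idx x) = (nth 0 x l != 0).
Proof.
rewrite mem_filter mem_iota add0n /=; case: (ltnP l (size x)) => ls.
  by rewrite andbT.
by rewrite nth_default // andbF.
Qed.

Lemma nonzero_idx_lt x l : l \in nonzero_idx x -> l < size x.
Proof. by rewrite mem_filter mem_iota => /and3P[]. Qed.

Lemma lowestP x c : reflect
  (nth 0 x c != 0 /\ forall l, l \in nonzero_idx x -> nth 0 x c <= nth 0 x l) (lowest x c).
Proof.
apply: (iffP andP) => -[c0 H]; split=> //.
  move=> l lx; have := allP H l; rewrite mem_iota /= nonzero_idx_lt //= => /(_ isT).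
  by rewrite mem_nonzero_idx in lx; rewrite (negbTE lx).
apply/allP => l _; case: eqP => //= /eqP l0; apply: H.
by rewrite mem_nonzero_idx.
Qed.

Lemma exists_lowest x : 0 < size (nonzero_idx x) -> exists2 c, c < size x & lowest x c.
Proof.
move=> s0; have ex : exists v, has (fun l => nth 0 x l == v) (nonzero_idx x).
  case E : (nonzero_idx x) s0 => [|l s] // _; exists (nth 0 x l).
  by rewrite /= eqxx.
case: (ex_minnP ex) => v /hasP[c cx /eqP Ev] min.
exists c; first exact: nonzero_idx_lt.
apply/lowestP; split=> [|l lx]; first by rewrite -mem_nonzero_idx.
by rewrite Ev; apply: min; apply/hasP; exists l.
Qed.

Lemma count_modn_iota (P : pred nat) n i :
  count (fun l => P (l %% n)) (iota i n) = count P (iota 0 n).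
Proof.
elim: i => [|i <-].
  by apply: eq_in_count => l; rewrite mem_iota => /= ln; rewrite modn_small.
case: n => // n; have E := iotaD i.+1 n 1; rewrite addn1 in E.
by rewrite E count_cat /= addn0 addnC addSnnS modnDr.
Qed.

Lemma modn_window n i c : c < n -> exists b, [/\ i <= b, b < i + n & b %% n = c].
Proof.
move=> cn; have n0 : 0 < n by lia.
exists (i + (c + (n - i %% n)) %% n); split; first by lia.
  by rewrite ltn_add2l ltn_mod.
rewrite modnDmr -modnDml.
have -> : i %% n + (c + (n - i %% n)) = c + n.
  by have := ltn_pmod i n0; lia.
by rewrite modnDr modn_small.
Qed.

Lemma count_window x i b m :
  i <= b < i + m -> m <= size x -> nth 0 x (b %% size x) != 0 ->
  count (fun l => nth 0 x (l %% size x) != 0) (iota i (b - i)) <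
  count (fun l => nth 0 x (l %% size x) != 0) (iota i m).
Proof.
move=> ib mx b0; have Em : m = (b - i) + (m - (b - i)) by lia.
rewrite [in X in _ < X]Em iotaD count_cat -{1}[count _ _]addn0 ltn_add2l.
have -> : i + (b - i) = b by lia.
have : 0 < m - (b - i) by lia.
by case: (m - (b - i)) => //= k _; rewrite b0.
Qed.

Lemma count_turn x i :
  count (fun l => nth 0 x (l %% size x) != 0) (iota i (size x)) = size (nonzero_idx x).
Proof. by rewrite (count_modn_iota (fun l => nth 0 x l != 0)) size_filter. Qed.

Section Subtraction.
Variables (x : seq nat) (j : nat).
Hypotheses (x2 : 1 < size (nonzero_idx x)) (jx : j \in nonzero_idx x).

Let a := subtractions x j.
Let x' := subtract x j a.
Let fits b := all (fun i => [|| i == j, nth 0 x i == 0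
                              | b * nth 0 x j <= nth 0 x i]) (iota 0 (size x)).

Lemma fitsP b : reflect
  (forall l, l \in nonzero_idx x -> l != j -> b * nth 0 x j <= nth 0 x l) (fits b).
Proof.
apply: (iffP allP) => H l lx.
  move=> lj; have := H l; rewrite mem_iota /= nonzero_idx_lt // => /(_ isT).
  by move: lx; rewrite mem_nonzero_idx (negbTE lj) => /negbTE ->.
by case: eqP => //= /eqP lj; case: eqP => //= /eqP l0; apply: H; rewrite ?mem_nonzero_idx.
Qed.

Lemma subtractions_fits : fits a.
Proof.
rewrite /a /subtractions.
have c0 : 0 < #|[pred b : 'I_(sumn x).+1 | fits b]|.
  by apply/card_gt0P; exists ord0; rewrite inE; apply/fitsP.
have [b fb ->] := eq_bigmax_cond (fun b : 'I_(sumn x).+1 => b : nat) c0.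
by rewrite inE in fb.
Qed.

Lemma exists_other : exists2 l, l \in nonzero_idx x & l != j.
Proof.
have uN : uniq (nonzero_idx x) by rewrite filter_uniq ?iota_uniq.
case E : (nonzero_idx x) x2 uN => [|l [|l' s]] // _ /and3P[+ _ _]; rewrite inE negb_or => /andP[ne _].
case: (eqVneq l j) => [lj|]; last by exists l => //; rewrite mem_head.
by exists l'; rewrite ?inE ?eqxx ?orbT // -lj eq_sym.
Qed.

Lemma subtractions_max b : fits b -> b <= a.
Proof.
move=> fb; have bs : b < (sumn x).+1.
  have [l lx lj] := exists_other.
  have lt : 0 < nth 0 x j by rewrite lt0n -mem_nonzero_idx.
  have := fitsP b fb l lx lj; have : nth 0 x l <= sumn x.
    rewrite sumnE (big_nth 0) big_mkord (bigD1 (Ordinal (nonzero_idx_lt lx))) //=.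
    exact: leq_addr.
  move=> H1 H2; rewrite ltnS; apply: leq_trans H1; apply: leq_trans H2.
  exact: leq_pmulr.
exact: (leq_bigmax_cond (Ordinal bs) fb).
Qed.

Lemma subtractions_le l : l \in nonzero_idx x -> l != j -> a * nth 0 x j <= nth 0 x l.
Proof. exact: (fitsP a subtractions_fits). Qed.

Lemma subtractions_lt :
  exists l, [/\ l \in nonzero_idx x, l != j & nth 0 x l < a.+1 * nth 0 x j].
Proof.
have : ~~ fits a.+1 by apply/negP => /subtractions_max; rewrite ltnn.
case/allPn => l _; rewrite !negb_or -ltnNge => /and3P[lj l0 lt].
by exists l; rewrite mem_nonzero_idx.
Qed.

Lemma subtractions_gt0 : lowest x j -> 0 < a.
Proof.
case/lowestP=> _ H; apply: subtractions_max; apply/fitsP => l lx _.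
by rewrite mul1n; apply: H.
Qed.

Lemma size_subtract : size x' = size x.
Proof. exact: size_mkseq. Qed.

Lemma nth_subtract l : nth 0 x' l =
  if l == j then nth 0 x l else nth 0 x l - a * nth 0 x j.
Proof.
case: (ltnP l (size x)) => ls; first by rewrite nth_mkseq.
rewrite (nth_default 0 ls) nth_default ?size_subtract //.
by case: ifP.
Qed.

Lemma subtract0 : a = 0 -> x' = x.
Proof.
move=> a0; apply: (@eq_from_nth _ 0) => [|l _]; first exact: size_subtract.
by rewrite nth_subtract a0 mul0n subn0; case: ifP.
Qed.

Lemma nonzero_idx_subtract : nonzero_idx x' = [seq l <- nonzero_idx x | nth 0 x' l != 0].
Proof.
rewrite /nonzero_idx size_subtract -filter_predI; apply: eq_filter => l /=.
rewrite nth_subtract; case: ifP => _; first by rewrite andbb.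
by case: (nth 0 x l) => [|y]; rewrite ?sub0n //= andbT.
Qed.

Lemma mem_nonzero_idx_subtract : j \in nonzero_idx x'.
Proof. by rewrite mem_nonzero_idx nth_subtract eqxx -mem_nonzero_idx. Qed.

Lemma new_barsE :
  new_bars x x' = [seq Bar l | l <- nonzero_idx x & nth 0 x' l == 0].
Proof.
rewrite /new_bars /nonzero_idx -filter_predI; congr map; apply: eq_filter => l /=.
by rewrite andbC.
Qed.

(** A maximal subtraction leaves an entry that is smaller than the one
    subtracted; if there is no new symbol then this entry is not zero. *)
Lemma subtract_not_lowest : new_bars x x' = [::] -> ~~ lowest x' j.
Proof.
rewrite new_barsE => nb; have [l [lx lj lt]] := subtractions_lt.
have l0 : nth 0 x' l != 0.
  apply/negP => l0; move/(congr1 size)/eqP: nb; rewrite size_map size_filter.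
  by rewrite -leqn0 leqNgt -has_count => /hasP[]; exists l.
apply/negP => /lowestP[_ /(_ l)]; rewrite mem_nonzero_idx => /(_ l0).
rewrite !nth_subtract eqxx (negbTE lj).
by move: lt; rewrite mulSn; lia.
Qed.

End Subtraction.

Definition visits (x : seq nat) (i b : nat) : nat :=
  count (fun l => nth 0 x (l %% size x) != 0) (iota i (b - i)).

(** A lowest entry is met so early that the zeros recorded before it, added to
    the [r] units already used up, are acceptable to the reader. *)
Definition spare (x : seq nat) (i r : nat) : Prop :=
  1 < size (nonzero_idx x) ->
  exists b, [/\ i <= b, lowest x (b %% size x) & r + visits x i b < size (nonzero_idx x)].

(** The last condition records that a run of zeros, and a positive element
    followed by no symbol, witness an entry that is not lowest. *)
Definition decodable_state (n : nat) (st : mstate) : Prop :=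
  exists z d, [/\ size (m_vec st) = n,
    reads (iota 0 n) 0 0 (m_out st) = Some (nonzero_idx (m_vec st), z, d),
    spare (m_vec st) (m_count st) (z + d)
  & 0 < z + d -> exists2 c, c \in nonzero_idx (m_vec st) & ~~ lowest (m_vec st) c].

Lemma spare_fresh x i : spare x i 0.
Proof.
move=> x2; have [|c cx lc] := @exists_lowest x; first by lia.
have [b [ib bi Eb]] := modn_window i cx.
exists b; rewrite Eb add0n; split=> //; rewrite -(count_turn x i).
apply: count_window; rewrite ?ib ?Eb //.
by case/lowestP: lc.
Qed.

(** The place where a full turn would end is not lowest, so the next lowest one
    comes at least one unit earlier. *)
Lemma spare_next x i : i %% size x \in nonzero_idx x -> ~~ lowest x (i %% size x) ->
  spare x i.+1 1.
Proof.
move=> ix nl x2; have [|c cx lc] := @exists_lowest x; first by lia.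
have [b [ib bi Eb]] := modn_window i.+1 cx.
have bn : b != i + size x.
  by apply: contra nl => /eqP E; rewrite -(modnDr i) -E Eb.
exists b; rewrite Eb; split=> //; rewrite -(count_turn x i).
case E : (size x) cx bi bn => [|m] // _ bi bn.
rewrite /= -E; rewrite mem_nonzero_idx in ix; rewrite ix ltn_add2l.
apply: count_window; rewrite ?E ?leqnSn //; first by lia.
by rewrite -E Eb; case/lowestP: lc.
Qed.

Lemma reads_bars (A : seq nat) d B : uniq B -> {subset B <= A} ->
  reads A 0 d [seq Bar j | j <- B] =
  Some ([seq i <- A | i \notin B], 0, if B is [::] then d else 0).
Proof.
elim: B A d => [|j B IH] A d /=.
  by move=> _ _; rewrite (eq_in_filter (a2 := predT)) ?filter_predT.
case/andP=> jB uB sB; rewrite sB ?mem_head // IH //; last first.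
  move=> i iB; rewrite mem_filter sB ?inE ?iB ?orbT // andbT.
  by apply: contra jB => /eqP <-.
rewrite /deactivate -filter_predI; congr (Some (_, _, _)); last by case: (B).
by apply: eq_filter => i /=; rewrite inE negb_or andbC.
Qed.

Lemma reads_zeros (A : seq nat) z d m : z + d + m < size A ->
  reads A z d (nseq m (Elt 0)) = Some (A, z + m, d).
Proof.
elim: m z => [|m IH] z lt /=; first by rewrite addn0.
rewrite ifT; last by rewrite addn1; lia.
by rewrite IH ?addSnnS //; lia.
Qed.

Lemma decodable_init n x : size x = n -> decodable_state n (minit x).
Proof.
move=> sx; exists 0, 0; split=> //=; last exact: spare_fresh.
rewrite -sx reads_bars ?filter_uniq ?iota_uniq //; last first.
  by move=> l; rewrite mem_filter => /andP[].
congr (Some (_, _, _)); last by case: [seq _ <- _ | _].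
by apply: eq_in_filter => l li; rewrite mem_filter li andbT.
Qed.

(** A zero uses up one unit of what the reader accepts, but the run also moves
    past one non-zero position towards the next lowest entry. A positive element
    starts a new count. *)
Lemma decodable_step n st : decodable_state n st -> decodable_state n (mstep st).
Proof.
case: st => i x out [z [d [/= sx R sp nl]]].
rewrite /mstep nonzerosE; case: leqP => [_|x2]; first by exists z, d.
have [b [ib lb lt]] := sp x2.
have n0 : 0 < size x by move: x2; rewrite /nonzero_idx; case: (x).
set j := i %% size x.
have skip : ~~ lowest x j -> i < b.
  rewrite leq_eqVlt in ib; case/orP: ib => // /eqP ib.
  by rewrite /j ib lb.
have visE : i < b -> visits x i b = (nth 0 x j != 0) + visits x i.+1 b.
  move=> ltb; rewrite /visits; have -> : b - i = (b - i.+1).+1 by lia.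
  by [].
case: eqP => [j0|/eqP j0].
  have ltb : i < b by apply: skip; rewrite /lowest j0.
  exists z, d; split=> //= _; exists b; split=> //.
  by move: lt; rewrite visE // j0 add0n.
have jx : j \in nonzero_idx x by rewrite mem_nonzero_idx.
set a := subtractions x j; set x' := subtract x j a.
case: (eqVneq a 0) => [a0|a0].
  have nlj : ~~ lowest x j.
    by apply/negP => /(subtractions_gt0 x2 jx); rewrite -/a a0.
  have Ex : x' = x := subtract0 a0.
  have nb : new_bars x x = [::].
    rewrite /new_bars (eq_filter (a2 := pred0)) ?filter_pred0 //.
    by move=> l /=; case: eqP.
  have ltb := skip nlj; move: lt; rewrite visE // j0 => lt.
  exists z.+1, d; split=> /=; rewrite ?Ex ?nb //.
  - rewrite reads_cat R /= a0 ifT //= addn1; lia.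
  - by move=> _; exists b; split=> //; lia.
  - by move=> _; exists j.
have Rb d0 : reads (nonzero_idx x) 0 d0 (new_bars x x') =
    Some (nonzero_idx x', 0, if new_bars x x' is [::] then d0 else 0).
  rewrite new_barsE // reads_bars; first last.
  - by move=> l; rewrite mem_filter => /andP[].
  - by rewrite !filter_uniq ?iota_uniq.
  rewrite nonzero_idx_subtract //; congr (Some (_, _, _)); last by case: [seq _ <- _ | _].
  by apply: eq_in_filter => l lx; rewrite mem_filter lx andbT.
have Ro : reads (iota 0 n) 0 0 (out ++ Elt a :: new_bars x x') =
    Some (nonzero_idx x', 0, if new_bars x x' is [::] then 1 else 0).
  rewrite reads_cat R /= (negbTE a0) addn0 ifT ?Rb //; lia.
have sx' : size x' = size x := size_subtract x j.
exists 0, (if new_bars x x' is [::] then 1 else 0); split=> //=.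
- by rewrite sx'.
- case nb : (new_bars x x') => [|s u]; last exact: spare_fresh.
  apply: spare_next; rewrite ?sx' -/j; first exact: mem_nonzero_idx_subtract.
  exact: subtract_not_lowest.
- case nb : (new_bars x x') => [|s u] // _; exists j; first exact: mem_nonzero_idx_subtract.
  exact: subtract_not_lowest.
Qed.

Lemma decodable_iter n x m : size x = n -> decodable_state n (iter m mstep (minit x)).
Proof.
by move=> sx; elim: m => [|m IH]; [exact: decodable_init | exact: decodable_step].
Qed.

(** A complete run leaves one active index; without its last symbol there are
    two of them. *)
Lemma readable_rcons n alpha j A z d :
  reads (iota 0 n) 0 0 (rcons alpha (Bar j)) = Some (A, z, d) -> size A = 1 ->
  readable n alpha.
Proof.
rewrite -cats1 reads_cat; case R : (reads _ _ _ alpha) => [[[B y] e]|] //=.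
case: ifP => // /andP[/eqP y0 jB] [EA _ _] sA.
exists B, e; rewrite R y0; split=> //.
have [uB _] := size_reads (iota_uniq 0 n) R.
by rewrite -(size_deactivate uB jB) EA sA.
Qed.

Lemma mstep_out st a bs : m_out (mstep st) = m_out st ++ Elt a :: bs ->
  let x := m_vec st in let j := m_count st %% size x in
  let x' := subtract x j a in
  [/\ 1 < size (nonzero_idx x), j \in nonzero_idx x, a = subtractions x j,
      bs = new_bars x x' & m_vec (mstep st) = x'].
Proof.
case: st => i x out /=; rewrite nonzerosE.
have abs (s : cf_symbol) u : out = out ++ s :: u -> False.
  by move/(congr1 size); rewrite size_cat /=; lia.
case: leqP => [_ /abs //|x2]; case: eqP => [_ /abs //|/eqP j0] /= E.
have : drop (size out) (out ++ Elt a :: bs) = Elt a :: bs by rewrite drop_size_cat.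
by rewrite -E drop_size_cat // => -[<- <-]; rewrite mem_nonzero_idx.
Qed.

(** If the last element is 1 then all remaining entries are equal, hence
    lowest: the element is the first one of its block. So replacing it by
    (0, 0, ..., 0, 1) still keeps the zeros within the bound of the reader. *)
Lemma extended_readable n alpha : extended_cf n alpha -> readable n alpha.
Proof.
case=> [[x [m [j [sx x1 out]]]]|[x [m [a [y [bs [j]]]]]]] /=.
  have [z [d [_ R _ _]]] := decodable_iter m sx.
  by rewrite out in R; apply: readable_rcons R _; rewrite -nonzerosE.
set st := iter m mstep (minit x) => -[sx [k1 x1] out yk ->].
have [z [d [sx' R sp nl]]] : decodable_state n st := decodable_iter m sx.
have [x2 jx Ea Eb Ex] := mstep_out out.
have [b [_ _ zd]] := sp x2.
have [z' [d' [_ + _ _]]] : decodable_state n (mstep st) := decodable_iter m.+1 sx.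
rewrite out reads_cat R /=; case: ifP => // _.
set v := m_vec st in x2 jx Ea Eb Ex zd nl sp *.
set c := m_count st %% size v in jx Ea Eb Ex.
rewrite !nonzerosE Ex in k1 x1 yk.
rewrite -/v in k1 yk.
have [l lv lc] := exists_other c x2.
have cx' : c \in nonzero_idx (subtract v c a) by rewrite Ea mem_nonzero_idx_subtract.
have eqv i : i \in nonzero_idx v -> i != c -> nth 0 v i = a * nth 0 v c.
  move=> iv ic; have := subtractions_le iv ic; rewrite -Ea => le.
  apply/eqP; rewrite eqn_leq le andbT -subn_eq0.
  have := nth_subtract v c i; rewrite -Ea (negbTE ic) => <-.
  apply: contraTT isT => ne.
  have ix' : i \in nonzero_idx (subtract v c a) by rewrite mem_nonzero_idx.
  case E : (nonzero_idx _) x1 cx' ix' => [|p [|]] // _; rewrite !inE => /eqP Ec /eqP Ei.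
  by rewrite Ei -Ec eqxx in ic.
have a0 : a != 0.
  apply/negP => /eqP a0; have := eqv l lv lc; rewrite a0 mul0n => l0.
  by rewrite mem_nonzero_idx l0 in lv.
rewrite (negbTE a0) => R'.
have rd : reads (iota 0 n) 0 0
      (rcons (m_out st ++ Elt a.-1 :: nseq y (Elt 0) ++ Elt 1 :: bs) (Bar j)) =
    reads (nonzero_idx v) z d (Elt a.-1 :: nseq y (Elt 0) ++ Elt 1 :: rcons bs (Bar j)).
  by rewrite rcons_cat reads_cat R rcons_cons rcons_cat rcons_cons.
suff H : reads (nonzero_idx v) z d (Elt a.-1 :: nseq y (Elt 0) ++ Elt 1 :: rcons bs (Bar j)) =
    Some (nonzero_idx (subtract v c a), z', d').
  by rewrite -rd in H; apply: readable_rcons H x1.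
have tail z0 d0 : z0 + d0 + y < size (nonzero_idx v) -> 
    reads (nonzero_idx v) z0 d0 (nseq y (Elt 0) ++ Elt 1 :: rcons bs (Bar j)) =
    Some (nonzero_idx (subtract v c a), z', d').
  move=> lt; rewrite reads_cat reads_zeros /=; last by lia.
  by rewrite -Ex ifT ?R' //; lia.
have [a1|a1] := eqVneq a 1.
  have zd0 : z + d = 0.
    case: posnP nl => // _ [] // e ev; case/negP; apply/lowestP.
    split=> [|i iv]; first by rewrite -mem_nonzero_idx.
    have eq1 k : k \in nonzero_idx v -> nth 0 v k = nth 0 v c.
      by case: (eqVneq k c) => [->//|kc] kv; rewrite (eqv k) // a1 mul1n.
    by rewrite !eq1.
  have -> : a.-1 = 0 by rewrite a1.
  by rewrite /= addn1 ifT ?tail //; lia.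
rewrite /=; have -> : a.-1 == 0 = false by lia.
by rewrite addn0 ifT ?tail //; lia.
Qed.

Local Open Scope fset_scope.
Local Open Scope ring_scope.

(** * Convex combinations of labelled points *)

Section Convexity.
Variables (R : realFieldType) (N : nat).

(** The weights in [conv] belong to points. Here they belong to labels, and
    several labels may denote the same point. *)
Lemma conv_comb (T : eqType) (r : seq T) (lam : T -> R) (p : T -> 'rV[R]_N)
    (s : seq 'rV[R]_N) :
  (forall l, l \in r -> 0 <= lam l) -> \sum_(l <- r) lam l = 1 ->
  (forall l, l \in r -> lam l != 0 -> p l \in s) ->
  conv s (\sum_(l <- r) lam l *: p l).
Proof.
move=> pos one ins.
(* a point listed several times shares its weight among its occurrences *)
pose share l := lam l / (count_mem (p l) s)%:R.
have total (V : lmodType R) (g : 'rV[R]_N -> V) :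
    \sum_(y <- s) (\sum_(l <- r | p l == y) share l) *: g y =
    \sum_(l <- r) lam l *: g (p l).
  transitivity (\sum_(y <- s) \sum_(l <- r | p l == y) share l *: g (p l)).
    by apply: eq_bigr => y _; rewrite scaler_suml; apply: eq_bigr => l /eqP ->.
  rewrite (exchange_big_dep predT) //=; apply: eq_big_seq => l lr.
  rewrite big_const_seq iter_addr_0 (eq_count (a2 := pred1 (p l))); last first.
    by move=> y; rewrite /= eq_sym.
  case: (eqVneq (lam l) 0) => [E|ne]; first by rewrite /share E mul0r !scale0r mul0rn.
  rewrite -scaler_nat scalerA /share mulrCA divff ?mulr1 // pnatr_eq0 -lt0n -has_count.
  by apply/hasP; exists (p l) => //=; exact: ins.
exists (fun y => \sum_(l <- r | p l == y) share l); split.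
- move=> y _; rewrite big_seq_cond; apply: sumr_ge0 => l /andP[lr _].
  by rewrite divr_ge0 ?pos ?ler0n.
- rewrite -one -[RHS](eq_bigr _ (fun l _ => mulr1 (lam l))).
  rewrite -(total R^o (fun=> 1)); apply: eq_bigr => y _; exact/esym/mulr1.
- by rewrite (total _ id).
Qed.

Lemma aff_indep_map (T : eqType) (r : seq T) (p : T -> 'rV[R]_N) :
  uniq r ->
  (forall mu : T -> R, \sum_(l <- r) mu l = 0 -> \sum_(l <- r) mu l *: p l = 0 ->
     forall l, l \in r -> mu l = 0) ->
  aff_indep [seq p l | l <- r].
Proof.
rewrite /aff_indep /differences; case: r => [|l0 r] /=; first by rewrite nil_free.
case/andP=> l0r ur H.
set X := [seq _ | _ <- _].
have EX : X = [seq p l - p l0 | l <- r] by rewrite /X -map_comp.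
have sX : size X = size r by rewrite EX size_map.
rewrite -[X]/(tval (in_tuple X)); apply/freeP => c c0 i; rewrite /= in c0.
have nthX (j : 'I_(size X)) : X`_j = p (nth l0 r j) - p l0.
  by rewrite [X in X`_ _]EX (nth_map l0) // -sX.
pose mu l := if l == l0 then - \sum_j c j else
  \sum_(j < size X | nth l0 r j == l) c j.
have mur (V : lmodType R) (g : T -> V) :
    \sum_(l <- r) mu l *: g l = \sum_j c j *: g (nth l0 r j).
  transitivity (\sum_(l <- r) \sum_(j < size X | nth l0 r j == l) c j *: g (nth l0 r j)).
    apply: eq_big_seq => l lr; rewrite /mu ifN; last by apply: contraNneq l0r => <-.
    by rewrite scaler_suml; apply: eq_bigr => j /eqP ->.
  rewrite (exchange_big_dep predT) //=; apply: eq_bigr => j _.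
  rewrite -big_filter (eq_filter (a2 := pred1 (nth l0 r j))); last by move=> l /=; rewrite eq_sym.
  by rewrite filter_pred1_uniq ?big_seq1 ?mem_nth -?sX.
have mu0 : mu l0 = - \sum_j c j by rewrite /mu eqxx.
have s0 : \sum_(l <- l0 :: r) mu l = 0.
  rewrite big_cons mu0 -[X in _ + X](eq_bigr _ (fun l _ => mulr1 (mu l))).
  by rewrite (mur R^o (fun=> 1)) addrC; apply/eqP; rewrite subr_eq0;
     apply/eqP/eq_bigr => j _; exact: mulr1.
have s1 : \sum_(l <- l0 :: r) mu l *: p l = 0.
  rewrite big_cons mu0 (mur _ p) scaleNr scaler_suml addrC -sumrB -[RHS]c0.
  by apply: eq_bigr => j _; rewrite nthX scalerBr.
have ir : nth l0 r i \in r by rewrite mem_nth // -sX.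
have := H mu s0 s1 (nth l0 r i); rewrite inE ir orbT => /(_ isT).
rewrite /mu ifN; last by apply: contraNneq l0r => <-.
rewrite (bigD1 i) //= big1 ?addr0 // => j /andP[/eqP E ji].
case/eqP: ji; apply/val_inj/eqP; rewrite /= -(nth_uniq l0 _ _ ur) ?E -?sX //.
Qed.

(** Affine independence of a family of points indexed by a finite set, which
    does not depend on an enumeration and is inherited by subsets. *)
Definition aff_free (T : choiceType) (p : T -> 'rV[R]_N) (s : {fset T}) : Prop :=
  forall mu : T -> R, \sum_(l <- s) mu l = 0 -> \sum_(l <- s) mu l *: p l = 0 ->
    forall l, l \in s -> mu l = 0.

Lemma aff_free_indep (T : choiceType) (p : T -> 'rV[R]_N) (s : {fset T}) :
  aff_free p s -> aff_indep [seq p l | l <- enum_fset s].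
Proof. by move=> H; apply: aff_indep_map (fset_uniq s) _. Qed.

Lemma aff_free_sub (T : choiceType) (p : T -> 'rV[R]_N) (s t : {fset T}) :
  t `<=` s -> aff_free p s -> aff_free p t.
Proof.
move=> /fsubsetP ts H mu s0 p0 l lt.
pose nu l := if l \in t then mu l else 0.
have E (V : lmodType R) (g : T -> V) :
    \sum_(l <- s) nu l *: g l = \sum_(l <- t) mu l *: g l.
  rewrite (eq_bigr (fun l => if l \in t then mu l *: g l else 0)); last first.
    by move=> i _; rewrite /nu; case: ifP => // _; rewrite scale0r.
  rewrite -big_mkcond -big_filter; apply: perm_big; apply: uniq_perm.
  - by rewrite filter_uniq // fset_uniq.
  - exact: fset_uniq.
  - move=> i; rewrite mem_filter -[i \in enum_fset s]/(i \in s).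
    by rewrite -[i \in enum_fset t]/(i \in t); case it : (i \in t) => //=; exact: ts.
have nu0 : \sum_(l <- s) nu l = 0.
  rewrite -[LHS](eq_bigr _ (fun l _ => mulr1 (nu l))) (E R^o (fun=> 1)) -[RHS]s0.
  by apply: eq_bigr => i _; exact: mulr1.
have nup : \sum_(l <- s) nu l *: p l = 0 by rewrite E.
by have := H nu nu0 nup l (ts l lt); rewrite /nu lt.
Qed.

Lemma aff_free_imfset (T U : choiceType) (g : U -> T) (p : T -> 'rV[R]_N)
    (s : {fset U}) :
  {in s &, injective g} -> aff_free (fun l => p (g l)) s -> aff_free p (g @` s).
Proof.
move=> gi H mu; rewrite !big_imfset //= => s0 p0 _ /imfsetP[l /= ls ->].
exact: (H (fun l => mu (g l))).
Qed.

Lemma aff_dim_free (T : choiceType) (p : T -> 'rV[R]_N) (s : {fset T}) :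
  aff_free p s -> aff_dim [seq p l | l <- enum_fset s] = #|` s|.-1.
Proof.
move/aff_free_indep/eqnP; rewrite /aff_dim /differences size_map size_behead.
by rewrite size_map.
Qed.

End Convexity.

(** * Points over the canonical deck *)

(** The simplex that raises the mast [w] by one edge, when the masts in [A] have
    reached the heights [h]. *)
Definition slab (A : seq nat) (h : nat -> nat) (w : nat) : {fset nat * nat} :=
  (w, (h w).+1) |` [fset (i, h i) | i in A].

Definition bump (h : nat -> nat) (w i : nat) : nat := (h i + (i == w))%N.

Lemma in_slab A h w l :
  (l \in slab A h w) = (l == (w, (h w).+1)) || ((l.1 \in A) && (l.2 == h l.1)).
Proof.
rewrite in_fset1U; congr (_ || _).
apply/imfsetP/andP => [[i iA ->] //|[iA /eqP E]]; exists l.1 => //.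
by rewrite -E; case: (l).
Qed.

Lemma card_slab A h w : uniq A -> w \in A -> #|` slab A h w| = (size A).+1.
Proof.
move=> uA wA; rewrite cardfsU1 card_imfset; last by move=> i j [].
rewrite (_ : _ \notin _ = true) /=; last first.
  by apply/negP => /imfsetP[i _ [-> /eqP]]; rewrite eqn_leq ltnn.
by rewrite add1n /= undup_id.
Qed.

Section CanonicalCoordinates.
Variables (R : realFieldType) (N k : nat).
Hypothesis kN : (k <= N)%N.

Definition canon_dir : 'rV[R]_N := \row_(l < N) (l < k)%N%:R.

Definition canon_base : seq 'rV[R]_N := [seq unit_vec N R i | i <- iota 0 k].

Definition canon_pt (l : nat * nat) : 'rV[R]_N := unit_vec N R l.1 + l.2%:R *: canon_dir.

(** The point at height [tau] over the point of the deck with barycentric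
    coordinates [beta]. *)
Definition bary_pt (beta : nat -> R) (tau : R) : 'rV[R]_N :=
  \sum_(i < k) beta i *: unit_vec N R i + tau *: canon_dir.

Lemma bary_ptE beta tau :
  bary_pt beta tau = \sum_(i < k) beta i *: unit_vec N R i + tau *: canon_dir.
Proof. by []. Qed.

Definition level (h : nat -> nat) (beta : nat -> R) : R :=
  \sum_(i < k) (h i)%:R * beta i.

Lemma bary_pt_entry beta tau (i : 'I_k) :
  bary_pt beta tau 0 (widen_ord kN i) = beta i + tau.
Proof.
rewrite !mxE /= ltn_ord mulr1 summxE (bigD1 i) //= !mxE eqxx mulr1.
rewrite big1 ?addr0 // => j ji; rewrite !mxE /=.
by rewrite (_ : (i == j :> nat) = false) ?mulr0 //; apply/eqP => E;
   case/eqP: ji; apply/val_inj.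
Qed.

Lemma bary_pt_inj (beta beta' : nat -> R) tau tau' : (0 < k)%N ->
  \sum_(i < k) beta i = \sum_(i < k) beta' i -> bary_pt beta tau = bary_pt beta' tau' ->
  tau = tau' /\ forall i, (i < k)%N -> beta i = beta' i.
Proof.
move=> k0 Es E.
have Ei (i : 'I_k) : beta i + tau = beta' i + tau'.
  by rewrite -!bary_pt_entry E.
have Et : tau = tau'.
  have : \sum_(i < k) (beta i + tau) = \sum_(i < k) (beta' i + tau').
    by apply: eq_bigr => i _; exact: Ei.
  rewrite !big_split /= Es => /addrI.
  rewrite !sumr_const card_ord -[LHS]mulr_natr -[RHS]mulr_natr.
  by apply: mulIf; rewrite pnatr_eq0 -lt0n.
split=> // i ik; have := Ei (Ordinal ik); rewrite Et /=; exact: addIr.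
Qed.

Lemma sum_by_mast (V : nmodType) (r : seq (nat * nat)) (F : nat -> nat * nat -> V) :
  (forall l, l \in r -> l.1 < k)%N ->
  \sum_(i < k) \sum_(l <- r | l.1 == i) F i l = \sum_(l <- r) F l.1 l.
Proof.
move=> rk; rewrite (exchange_big_dep predT) //=; apply: eq_big_seq => l lr.
rewrite (bigD1 (Ordinal (rk l lr))) //= big1 ?addr0 // => i /andP[/eqP E].
by case/eqP; apply: val_inj.
Qed.

Lemma comb_bary_pt (r : seq (nat * nat)) (lam : nat * nat -> R) :
  (forall l, l \in r -> l.1 < k)%N ->
  \sum_(l <- r) lam l *: canon_pt l =
  bary_pt (fun i => \sum_(l <- r | l.1 == i) lam l) (\sum_(l <- r) l.2%:R * lam l).
Proof.
move=> rk; rewrite /bary_pt.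
under [X in _ = X + _]eq_bigr do rewrite scaler_suml.
rewrite (sum_by_mast (fun i l => lam l *: unit_vec N R i)) // scaler_suml -big_split.
by apply: eq_bigr => l _ /=; rewrite scalerDr scalerA [lam l * _]mulrC.
Qed.

(** On each mast, the two points with the heights [h] and [g] are combined in the
    ratio in which [tau] divides the interval between the two levels. *)
Lemma conv_between (s : seq (nat * nat)) (h g : nat -> nat) (beta : nat -> R) tau :
  (forall i, (i < k)%N -> 0 <= beta i) -> \sum_(i < k) beta i = 1 ->
  (forall i, (i < k)%N -> beta i != 0 -> (i, h i) \in s /\ (i, g i) \in s) ->
  level h beta <= tau <= level g beta ->
  conv [seq canon_pt l | l <- s] (bary_pt beta tau).
Proof.
move=> b0 b1 ins /andP[h1 g1].
(* the position of tau between the two levels, as a fraction; it is 0 when the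
   levels coincide *)
pose th := (tau - level h beta) / (level g beta - level h beta).
have hg : 0 <= level g beta - level h beta by rewrite subr_ge0; apply: le_trans g1.
have th0 : 0 <= th by rewrite divr_ge0 // subr_ge0.
have th1 : 0 <= 1 - th.
  rewrite subr_ge0 /th; have [E|ne] := eqVneq (level g beta - level h beta) 0.
    by rewrite E invr0 mulr0.
  by rewrite ler_pdivrMr ?mul1r ?lerB // lt_def ne.
have thE : th * (level g beta - level h beta) = tau - level h beta.
  rewrite /th; have [E|ne] := eqVneq (level g beta - level h beta) 0; last by rewrite divfK.
  rewrite E mulr0; apply/esym/eqP; rewrite subr_eq0 eq_le h1 andbT.
  by move/eqP: E; rewrite subr_eq0 => /eqP <-.
pose r := [seq (i, b) | i <- enum 'I_k, b <- [:: false; true]].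
pose lam (ib : 'I_k * bool) := (if ib.2 then th else 1 - th) * beta ib.1.
pose p (ib : 'I_k * bool) := canon_pt (nat_of_ord ib.1, if ib.2 then g ib.1 else h ib.1).
have sumr (V : lmodType R) (F : 'I_k * bool -> V) :
    \sum_(l <- r) lam l *: F l =
    \sum_(i < k) beta i *: ((1 - th) *: F (i, false) + th *: F (i, true)).
  rewrite big_allpairs_dep /= big_enum /=; apply: eq_bigr => i _.
  by rewrite !big_cons big_nil addr0 /lam /= scalerDr !scalerA ![beta i * _]mulrC.
have -> : bary_pt beta tau = \sum_(l <- r) lam l *: p l.
  rewrite sumr /bary_pt /p /canon_pt /=.
  have -> : tau = \sum_(i < k) beta i * ((1 - th) * (h i)%:R + th * (g i)%:R).
    have -> : tau = level h beta + th * (level g beta - level h beta).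
      by rewrite thE addrC subrK.
    rewrite /level -sumrB mulr_sumr -big_split; apply: eq_bigr => i _ /=.
    by ring.
  rewrite scaler_suml -big_split; apply: eq_bigr => i _ /=.
  rewrite !scalerDr addrACA -!scalerDr -!scalerDl subrK !scale1r !scalerA -scalerDl.
  by rewrite scalerDr scalerA.
apply: conv_comb.
- move=> [i b] _; rewrite /lam /=; apply: mulr_ge0; last exact: b0.
  by case: b.
- rewrite -[LHS](eq_bigr _ (fun l _ => mulr1 (lam l))) (sumr R^o (fun=> 1)) -[RHS]b1.
  apply: eq_bigr => i _.
  by rewrite -[LHS]/(beta i * ((1 - th) * 1 + th * 1)); ring.
- move=> [i b] _; rewrite /lam /p /= mulf_eq0 negb_or => /andP[_ bi].
  by apply: map_f; have [] := ins i _ bi; first exact: ltn_ord; case: b.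
Qed.

(** The barycentric coordinate of a mast is the total weight of its labels, and
    the height is the mean height of all labels. So bounds for the labels are
    bounds for the height, and a mast without labels has the coordinate 0. *)
Lemma conv_out (s : seq (nat * nat)) x : (forall l, l \in s -> l.1 < k)%N ->
  conv [seq canon_pt l | l <- s] x ->
  exists (beta : nat -> R) tau, [/\ forall i, (i < k)%N -> 0 <= beta i,
    \sum_(i < k) beta i = 1, x = bary_pt beta tau,
    forall h : nat -> nat,
      ((forall l, l \in s -> h l.1 <= l.2)%N -> level h beta <= tau) /\
      ((forall l, l \in s -> l.2 <= h l.1)%N -> tau <= level h beta)
  & forall i, beta i != 0 -> exists2 l, l \in s & l.1 = i].
Proof.
move=> sk [wt [w0 w1 ->]]; rewrite !big_map in w1 *.
pose lam l := wt (canon_pt l).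
have lam0 l : l \in s -> 0 <= lam l by move=> ls; apply: w0; apply: map_f.
pose beta i := \sum_(l <- s | l.1 == i) lam l.
have levelE h : level h beta = \sum_(l <- s) (h l.1)%:R * lam l.
  rewrite -(sum_by_mast (fun i l => (h i)%:R * lam l)) //.
  by apply: eq_bigr => i _; rewrite mulr_sumr.
exists beta, (\sum_(l <- s) l.2%:R * lam l); split.
- move=> i _; rewrite /beta big_seq_cond; apply: sumr_ge0 => l /andP[ls _].
  exact: lam0.
- by rewrite -w1 (sum_by_mast (fun _ l => lam l)).
- exact: comb_bary_pt.
- move=> h; rewrite levelE; split=> hs; rewrite big_seq [X in _ <= X]big_seq.
    by apply: ler_sum => l ls; rewrite ler_wpM2r ?lam0 // ler_nat hs.
  by apply: ler_sum => l ls; rewrite ler_wpM2r ?lam0 // ler_nat hs.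
- move=> i; case: (boolP (has (fun l => l.1 == i) s)) => [/hasP[l ls /eqP E] _|no].
    by exists l.
  by rewrite /beta big_hasC ?eqxx.
Qed.

End CanonicalCoordinates.

(** * The staircase triangulation *)

Definition hgt (w : seq nat) (p i : nat) : nat := count_mem i (take p w).

Definition slabs (A w : seq nat) : seq {fset nat * nat} :=
  mkseq (fun p => slab A (hgt w p) (nth 0%N w p)) (size w).

(** The prism over the canonical deck whose masts are raised, one edge at a
    time, in the order prescribed by [w]. *)
Definition stair (R : realFieldType) (N k : nat) (w : seq nat) : prism R N :=
  Prism (canon_base R N k) (canon_dir R N k)
        [seq count_mem i w | i <- iota 0 k] (slabs (iota 0 k) w).

Lemma hgt_next w p i : (p < size w)%N -> hgt w p.+1 i = bump (hgt w p) (nth 0%N w p) i.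
Proof.
move=> pw; rewrite /hgt (take_nth 0%N) // -cats1 count_cat /= addn0 /bump.
by rewrite [nth _ _ _ == _]eq_sym.
Qed.

Lemma hgt_mono w p q i : (p <= q)%N -> (hgt w p i <= hgt w q i)%N.
Proof.
move=> pq; rewrite /hgt -(subnKC pq) takeD count_cat; exact: leq_addr.
Qed.

Lemma hgt0 w i : hgt w 0 i = 0%N. Proof. by rewrite /hgt take0. Qed.

Lemma hgt_size w i : hgt w (size w) i = count_mem i w.
Proof. by rewrite /hgt take_size. Qed.

Lemma slab_ext A h h' w : {in A, h =1 h'} -> w \in A -> slab A h w = slab A h' w.
Proof.
move=> E wA; apply/fsetP => l; rewrite !in_slab E //; congr (_ || _).
by case lA: (l.1 \in A) => //=; rewrite E.
Qed.

Lemma slab_between A h w l : w \in A -> l \in slab A h w ->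
  [/\ l.1 \in A, (h l.1 <= l.2)%N & (l.2 <= bump h w l.1)%N].
Proof.
move=> wA; rewrite in_slab /bump => /orP[/eqP -> /=|/andP[lA /eqP ->]].
  by rewrite eqxx addn1 leqnSn.
by rewrite leqnn leq_addr.
Qed.

Lemma slab_low A h w i : i \in A -> (i, h i) \in slab A h w.
Proof. by move=> iA; rewrite in_slab /= iA eqxx orbT. Qed.

Lemma slab_up A h w i : i \in A -> (i, bump h w i) \in slab A h w.
Proof.
move=> iA; rewrite in_slab /= iA /bump; case: (eqVneq i w) => [->|_].
  by rewrite addn1 eqxx.
by rewrite addn0 eqxx orbT.
Qed.

(** Heights only grow. So a common label lies neither above the heights behind
    the earlier simplex nor below the heights in front of the later one. *)
Lemma in_slabI A w p q l : all (mem A) w -> (p < q < size w)%N ->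
  (l \in slab A (hgt w p) (nth 0%N w p)
           `&` slab A (hgt w q) (nth 0%N w q)) =
  [&& l.1 \in A, hgt w p.+1 l.1 == hgt w q l.1
    & l.2 == hgt w q l.1].
Proof.
move=> /allP wA /andP[pq qw]; have pw := ltn_trans pq qw.
have pA : nth 0%N w p \in A by apply/wA/mem_nth.
have qA : nth 0%N w q \in A by apply/wA/mem_nth.
rewrite in_fsetI; apply/andP/and3P => [[lp lq]|[lA /eqP E /eqP El]].
  have [lA _] := slab_between pA lp; have [_ + _] := slab_between qA lq.
  rewrite -hgt_next // => h1 h2; have h3 := hgt_mono w l.1 pq.
  by rewrite lA !eqn_leq h1 h3 (leq_trans h2 h3) (leq_trans h1 h2).
have -> : l = (l.1, hgt w q l.1) by rewrite -El; case: (l).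
by split; [rewrite -E hgt_next //; exact: slab_up | exact: slab_low].
Qed.

Lemma card_slabI A w p q : uniq A -> all (mem A) w -> (p < q < size w)%N ->
  (#|` slab A (hgt w p) (nth 0%N w p) `&` slab A (hgt w q) (nth 0%N w q)| <= size A)%N
  /\ (#|` slab A (hgt w p) (nth 0%N w p) `&` slab A (hgt w q) (nth 0%N w q)| = size A
      <-> q = p.+1).
Proof.
move=> uA wA pqw; have /andP[pq qw] := pqw.
pose B := [seq i <- A | hgt w p.+1 i == hgt w q i].
have -> : slab A (hgt w p) (nth 0%N w p) `&` slab A (hgt w q) (nth 0%N w q) =
    [fset (i, hgt w q i) | i in B].
  apply/fsetP => l; rewrite in_slabI //; apply/and3P/imfsetP.
    move=> [lA E /eqP El]; exists l.1; first by rewrite /= mem_filter E lA.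
    by rewrite -El; case: (l).
  by move=> [i /=]; rewrite mem_filter => /andP[E iA] -> /=.
have uB : uniq B by rewrite filter_uniq.
rewrite card_imfset => [|i j []] //=; rewrite undup_id //.
split; first by rewrite size_filter count_size.
rewrite size_filter; split=> [/eqP|->]; last first.
  by rewrite (eq_count (a2 := predT)) ?count_predT // => i; rewrite /= eqxx.
rewrite -all_count => /allP all_eq.
apply/eqP; rewrite eqn_leq pq andbT leqNgt; apply/negP => pq1.
have p1w : (p.+1 < size w)%N by apply: ltn_trans qw.
have cA : nth 0%N w p.+1 \in A by apply: (allP wA); exact: mem_nth.
have := hgt_mono w (nth 0%N w p.+1) pq1.
by rewrite hgt_next // /bump eqxx -(eqP (all_eq _ cA)) addn1 ltnn.
Qed.

Section Staircase.
Variables (R : realFieldType) (N k : nat).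
Hypotheses (kN : (k <= N)%N) (k0 : (0 < k)%N).

Local Notation canon_pt := (@canon_pt R N k).
Local Notation bary_pt := (@bary_pt R N k).
Local Notation level := (@level R k).

Lemma sum_iota (V : nmodType) (F : nat -> V) :
  \sum_(i <- iota 0 k) F i = \sum_(i < k) F i.
Proof. by rewrite -(big_mkord predT F) /index_iota subn0. Qed.

Lemma point_canonical (D : prism R N) l :
  base D = canon_base R N k -> dir D = canon_dir R N k -> (l.1 < k)%N ->
  point D l = canon_pt l.
Proof.
move=> Eb Ed lk; rewrite /point Eb Ed (nth_map 0%N) ?size_iota //.
by rewrite nth_iota.
Qed.

Lemma points_canonical (D : prism R N) (s : {fset nat * nat}) :
  base D = canon_base R N k -> dir D = canon_dir R N k ->
  (forall l, l \in s -> l.1 < k)%N -> points D s = [seq canon_pt l | l <- enum_fset s].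
Proof. by move=> Eb Ed sk; apply/eq_in_map => l ls; rewrite point_canonical ?sk. Qed.

Lemma bary_pt0 : bary_pt (fun=> 0) 0 = 0.
Proof. by rewrite bary_ptE big1 ?scale0r ?addr0 // => i _; rewrite scale0r. Qed.

Lemma comb0 (r : seq (nat * nat)) (mu : nat * nat -> R) :
  (forall l, l \in r -> l.1 < k)%N ->
  \sum_(l <- r) mu l = 0 -> \sum_(l <- r) mu l *: canon_pt l = 0 ->
  (forall i, (i < k)%N -> \sum_(l <- r | l.1 == i) mu l = 0) /\
  \sum_(l <- r) l.2%:R * mu l = 0.
Proof.
move=> rk s0; rewrite comb_bary_pt // -bary_pt0 => /(bary_pt_inj kN k0)[|t0 b0] //.
by rewrite (sum_by_mast (fun _ => mu)) // s0 big1.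
Qed.

Lemma slab_lt h c l : (c < k)%N -> l \in slab (iota 0 k) h c -> (l.1 < k)%N.
Proof.
move=> ck; rewrite in_slab mem_iota => /orP[/eqP ->|/andP[]] //.
Qed.

(** In an affine relation each mast has the total weight 0, and so the weighted
    sum of the heights [h] vanishes. As all labels but the top one have these
    heights, the weight of the top one is 0. *)
Lemma slab_aff_free A h c : {subset A <= iota 0 k} -> c \in A ->
  aff_free canon_pt (slab A h c).
Proof.
move=> sA cA mu; set s := slab A h c => s0 p0.
have sk l : l \in enum_fset s -> (l.1 < k)%N.
  by move=> /(slab_between cA)[/sA]; rewrite mem_iota.
have [b0 t0] := comb0 sk s0 p0.
have us : uniq (enum_fset s) := fset_uniq s.
have top_s : (c, (h c).+1) \in enum_fset s by rewrite [_ \in _]in_slab eqxx.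
have low i l : l \in enum_fset s -> l.1 = i -> l != (c, (h c).+1) -> l = (i, h i).
  rewrite [_ \in _]in_slab => + <- ne; rewrite (negbTE ne) /= => /andP[_ /eqP <-].
  by case: (l).
have top0 : mu (c, (h c).+1) = 0.
  have := t0; rewrite (bigD1_seq _ top_s) //=.
  have E : \sum_(l <- enum_fset s) (h l.1)%:R * mu l = 0.
    rewrite -(sum_by_mast (fun i l => (h i)%:R * mu l) sk) big1 // => i _.
    by rewrite -mulr_sumr b0 ?mulr0.
  move: E; rewrite (bigD1_seq _ top_s) //= => E1 E2.
  have E3 : \sum_(l <- enum_fset s | l != (c, (h c).+1)) l.2%:R * mu l =
      \sum_(l <- enum_fset s | l != (c, (h c).+1)) (h l.1)%:R * mu l.
    rewrite big_seq_cond [RHS]big_seq_cond; apply: eq_bigr => l /andP[ls ne].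
    by rewrite (low _ _ ls erefl ne).
  by move: E1 E2; rewrite E3 -natr1 mulrDl mul1r; lra.
move=> l ls; have [-> //|ne] := eqVneq l (c, (h c).+1).
have := b0 l.1 (sk l ls); rewrite big_mkcond (bigD1_seq l) //= eqxx.
rewrite big_seq_cond big1 ?addr0 // => l' /andP[l's ll'].
case: eqP => // E; have [-> //|ne'] := eqVneq l' (c, (h c).+1).
by case/eqP: ll'; rewrite (low _ _ ls erefl ne) (low _ _ l's E ne').
Qed.

Lemma level_le (h g : nat -> nat) (beta : nat -> R) :
  (forall i, (i < k)%N -> 0 <= beta i) -> (forall i, (i < k)%N -> (h i <= g i)%N) ->
  level h beta <= level g beta.
Proof.
by move=> b0 hg; apply: ler_sum => i _; rewrite ler_wpM2r ?b0 // ler_nat hg.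
Qed.

Lemma conv_slab h c x : (c < k)%N ->
  conv [seq canon_pt l | l <- enum_fset (slab (iota 0 k) h c)] x <->
  exists (beta : nat -> R) tau, [/\ forall i, (i < k)%N -> 0 <= beta i,
    \sum_(i < k) beta i = 1, level h beta <= tau <= level (bump h c) beta
    & x = bary_pt beta tau].
Proof.
move=> ck; have cA : c \in iota 0 k by rewrite mem_iota.
split=> [/conv_out[|beta [tau [b0 b1 -> lv _]]]|[beta [tau [b0 b1 lv ->]]]].
- by move=> l; apply: slab_lt.
- exists beta, tau; split=> //; apply/andP; split; apply lv => l /(slab_between cA)[] //.
- apply: (conv_between N (h := h) (g := bump h c)) => // i ik _.
  by split; [apply: slab_low | apply: slab_up]; rewrite mem_iota.
Qed.

(** Over a fixed point of the deck the levels increase along the staircase, so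
    the intervals between consecutive levels leave no gap. *)
Lemma level_chain w (beta : nat -> R) tau : (0 < size w)%N ->
  (forall i, (i < k)%N -> 0 <= beta i) ->
  level (hgt w 0) beta <= tau <= level (hgt w (size w)) beta ->
  exists2 p, (p < size w)%N &
    level (hgt w p) beta <= tau <= level (hgt w p.+1) beta.
Proof.
move=> w0 b0 /andP[t0 t1].
have ex : exists p, tau <= level (hgt w p) beta by exists (size w).
case: (ex_minnP ex) => -[|p] tp min.
  exists 0%N => //; rewrite t0 (le_trans tp) //.
  by apply: level_le => // i _; apply: hgt_mono.
exists p; first exact: min t1.
by rewrite tp andbT; have [//|/ltW ?] := leP (level (hgt w p) beta) tau;
   have := min p; rewrite ltnn => /(_ _)/negP[].
Qed.

Section Word.
Variable w : seq nat.
Hypothesis wk : all (mem (iota 0 k)) w.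

Local Notation D := (stair R N k w).

Lemma letter_lt p : (p < size w)%N -> (nth 0%N w p < k)%N.
Proof. by move=> pw; have := allP wk _ (mem_nth 0%N pw); rewrite /= mem_iota. Qed.

Lemma nth_slabs p : (p < size w)%N ->
  nth fset0 (slabs (iota 0 k) w) p = slab (iota 0 k) (hgt w p) (nth 0%N w p).
Proof. by move=> pw; rewrite nth_mkseq. Qed.

Lemma mem_slabs s : s \in slabs (iota 0 k) w ->
  exists2 p, (p < size w)%N & s = slab (iota 0 k) (hgt w p) (nth 0%N w p).
Proof.
by case/mapP => p; rewrite mem_iota /= add0n => pw ->; exists p.
Qed.

Lemma slabs_mem p : (p < size w)%N ->
  slab (iota 0 k) (hgt w p) (nth 0%N w p) \in slabs (iota 0 k) w.
Proof. by move=> pw; apply/mapP; exists p; rewrite ?mem_iota. Qed.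

Lemma size_canon_base : size (canon_base R N k) = k.
Proof. by rewrite size_map size_iota. Qed.

Lemma stair_data : prism_data D.
Proof.
split; rewrite /= ?size_canon_base // ?size_map ?size_iota //.
- apply: aff_indep_map => [|mu]; first exact: iota_uniq.
  rewrite !sum_iota => s0 e0 l; rewrite mem_iota => lk.
  have [||_ ->//] := bary_pt_inj (beta := mu) (beta' := fun=> 0) (tau := 0) (tau' := 0) kN k0.
    by rewrite s0 big1.
  by rewrite bary_pt0 bary_ptE e0 scale0r addr0.
- apply/eqP => /matrixP/(_ 0 (Ordinal (leq_trans k0 kN))); rewrite !mxE k0 /=.
  by apply/eqP; rewrite oner_eq0.
- have one i : (i < k)%N -> unit_vec N R i *m (canon_dir R N k)^T = 1%:M.
    move=> ik; apply/matrixP => a b; rewrite !mxE !ord1 eqxx.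
    rewrite (bigD1 (Ordinal (leq_trans ik kN))) //= !mxE eqxx ik mulr1 big1 ?addr0 //.
    by move=> j ji; rewrite !mxE (_ : (j == i :> nat) = false) ?mul0r //;
       apply/eqP => E; case/eqP: ji; apply: val_inj.
  move=> x y /mapP[i + ->] /mapP[j + ->]; rewrite !mem_iota /= !add0n => ik jk.
  by rewrite mulmxBl !one // subrr.
Qed.

Lemma stair_on_mast l : on_mast D l =
  (l.1 < k)%N && (l.2 <= count_mem l.1 w)%N.
Proof.
rewrite /on_mast /= size_canon_base; case: ltnP => //= lk.
by rewrite (nth_map 0%N) ?size_iota // nth_iota.
Qed.

Lemma stair_labels l : (0 < size w)%N ->
  on_mast D l <-> exists2 s, s \in simps D & l \in s.
Proof.
move=> w0; rewrite stair_on_mast; split=> [/andP[lk lw]|[s /mem_slabs[p pw ->]]].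
- have lA : l.1 \in iota 0 k by rewrite mem_iota.
  have ex : exists p, (l.2 <= hgt w p l.1)%N by exists (size w); rewrite hgt_size.
  have El : l = (l.1, l.2) by case: (l).
  case: (ex_minnP ex) => -[|p] lp min.
    exists (slab (iota 0 k) (hgt w 0) (nth 0%N w 0)); first exact: slabs_mem.
    have -> : l = (l.1, hgt w 0 l.1).
      by rewrite hgt0 [LHS]El; congr (_, _); move: lp; rewrite hgt0; case: (l.2).
    exact: slab_low.
  have pw : (p < size w)%N by apply: min; rewrite hgt_size.
  exists (slab (iota 0 k) (hgt w p) (nth 0%N w p)); first exact: slabs_mem.
  have -> : l = (l.1, hgt w p.+1 l.1); last by rewrite hgt_next //; apply: slab_up.
  rewrite [LHS]El; congr (_, _); apply/eqP; rewrite eqn_leq lp.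
  have : (hgt w p l.1 < l.2)%N.
    by rewrite ltnNge; apply/negP => /min; rewrite ltnn.
  by apply: leq_trans; rewrite hgt_next // /bump; case: (_ == _); rewrite ?addn1 ?addn0.
- have cA : nth 0%N w p \in iota 0 k by rewrite mem_iota letter_lt.
  move=> /(slab_between cA)[]; rewrite mem_iota /= add0n => lk _ le.
  rewrite lk (leq_trans le) // -hgt_next // -hgt_size.
  exact: hgt_mono.
Qed.

Lemma stair_points p : (p < size w)%N ->
  points D (slab (iota 0 k) (hgt w p) (nth 0%N w p)) =
  [seq canon_pt l | l <- enum_fset (slab (iota 0 k) (hgt w p) (nth 0%N w p))].
Proof.
move=> pw; apply: points_canonical => // l; apply: slab_lt; exact: letter_lt.
Qed.

Lemma stair_polyhedron x : polyhedron D x <->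
  exists (beta : nat -> R) tau, [/\ forall i, (i < k)%N -> 0 <= beta i,
    \sum_(i < k) beta i = 1,
    level (hgt w 0) beta <= tau <= level (hgt w (size w)) beta
    & x = bary_pt beta tau].
Proof.
have mem_dn l : l \in deck D ++ nest D ->
    [/\ (l.1 < k)%N, (hgt w 0 l.1 <= l.2)%N & (l.2 <= hgt w (size w) l.1)%N].
  rewrite /deck /nest /= size_canon_base mem_cat => /orP[]/mapP[i].
    by rewrite mem_iota => ik -> /=; rewrite hgt0.
  rewrite mem_iota => /= ik -> /=.
  by rewrite hgt0 hgt_size (nth_map 0%N) ?size_iota // nth_iota.
have -> : polyhedron D x = conv [seq canon_pt l | l <- deck D ++ nest D] x.
  rewrite /polyhedron; congr (conv _ x); apply/eq_in_map => l /mem_dn[lk _ _].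
  by rewrite (point_canonical (D := D)).
split=> [/conv_out[|beta [tau [b0 b1 -> lv _]]]|[beta [tau [b0 b1 lv ->]]]].
- by move=> l /mem_dn[].
- by exists beta, tau; split=> //; apply/andP; split; apply lv => l /mem_dn[].
- apply: (conv_between N (h := hgt w 0) (g := hgt w (size w))) => // i ik _.
  rewrite !mem_cat; split; apply/orP; [left|right].
    by apply/mapP; exists i; rewrite ?hgt0 // mem_iota size_canon_base.
  apply/mapP; exists i; rewrite ?mem_iota ?size_canon_base //=.
  by rewrite hgt_size (nth_map 0%N) ?size_iota // nth_iota.
Qed.

Lemma conv_stair p x : (p < size w)%N ->
  conv (points D (slab (iota 0 k) (hgt w p) (nth 0%N w p))) x <->
  exists (beta : nat -> R) tau, [/\ forall i, (i < k)%N -> 0 <= beta i,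
    \sum_(i < k) beta i = 1, level (hgt w p) beta <= tau <= level (hgt w p.+1) beta
    & x = bary_pt beta tau].
Proof.
move=> pw; rewrite stair_points //.
have E (beta : nat -> R) : level (bump (hgt w p) (nth 0%N w p)) beta = level (hgt w p.+1) beta.
  by apply: eq_bigr => i _; rewrite hgt_next.
apply: (iff_trans (conv_slab _ _ (letter_lt pw))).
by split=> -[beta [tau H]]; exists beta, tau; move: H; rewrite E.
Qed.

End Word.
End Staircase.

Section Prismatic.
Variables (R : realFieldType) (N k : nat).
Hypotheses (kN : (k <= N)%N) (k0 : (0 < k)%N).

Local Notation canon_pt := (@canon_pt R N k).
Local Notation bary_pt := (@bary_pt R N k).
Local Notation level := (@level R k).
Local Notation stair := (@stair R N k).

Lemma level_eq (h g : nat -> nat) (beta : nat -> R) :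
  (forall i, (i < k)%N -> 0 <= beta i) -> (forall i, (i < k)%N -> (h i <= g i)%N) ->
  level g beta <= level h beta ->
  forall i, (i < k)%N -> beta i != 0 -> h i = g i.
Proof.
move=> b0 hg le i ik bi; have := level_le b0 hg => ge.
have E : \sum_(j < k) ((g j)%:R * beta j - (h j)%:R * beta j) = 0.
  by rewrite sumrB; apply/eqP; rewrite subr_eq0 eq_le le ge.
have := psumr_eq0P _ E (i := Ordinal ik) isT; rewrite /= => H.
have /eqP : (g i)%:R * beta i - (h i)%:R * beta i = 0.
  by apply: H => j _; rewrite -mulrBl mulr_ge0 ?b0 // subr_ge0 ler_nat hg.
by rewrite -mulrBl mulf_eq0 (negbTE bi) orbF subr_eq0 eqr_nat => /eqP.
Qed.

(** A common point lies on the upper level of the earlier simplex and on the lower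
    level of the later one. So the masts raised in between have the coordinate 0
    there. *)
Lemma stair_meet w p q x : all (mem (iota 0 k)) w -> (p < q < size w)%N ->
  let s := slab (iota 0 k) (hgt w p) (nth 0%N w p) in
  let s' := slab (iota 0 k) (hgt w q) (nth 0%N w q) in
  conv (points (stair w) s) x -> conv (points (stair w) s') x ->
  conv (points (stair w) (s `&` s')) x.
Proof.
move=> wk pqw s s'; have /andP[pq qw] := pqw; have pw := ltn_trans pq qw.
case/(conv_stair wk _ pw) => b [t [b0 b1 /andP[_ lp] ->]].
case/(conv_stair wk _ qw) => b' [t' [b0' b1' /andP[lq _] E]].
have [|Et Eb] := bary_pt_inj kN k0 _ E; first by rewrite b1.
have lE h : level h b' = level h b by apply: eq_bigr => i _; rewrite Eb.
rewrite -Et lE in lq.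
have le : level (hgt w q) b <= level (hgt w p.+1) b := le_trans lq lp.
have mono i : (i < k)%N -> (hgt w p.+1 i <= hgt w q i)%N by move=> _; exact: hgt_mono.
have same := level_eq b0 mono le.
rewrite (points_canonical (k := k) (D := stair w)) //; last first.
  by move=> l /fsetIP[+ _]; apply: slab_lt; exact: letter_lt.
apply: (conv_between N (h := hgt w q) (g := hgt w q)) => // [i ik bi|].
  suff: (i, hgt w q i) \in s `&` s' by [].
  by rewrite in_slabI //= mem_iota ik same ?eqxx.
by rewrite lq (le_trans lp) // level_le.
Qed.

Lemma stair_prismatic w : all (mem (iota 0 k)) w -> prismatic_diagram (stair w).
Proof.
move=> wk; split; first exact: stair_data.
have wA p : (p < size w)%N -> nth 0%N w p \in iota 0 k.
  by move=> pw; rewrite mem_iota letter_lt.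
case: ifP => [/allP z|/negbT nonzero_idx].
  rewrite /= /slabs; case: w wk z wA => // c w /= /andP[ck _] z _.
  have := z (count_mem c (c :: w)); rewrite /= eqxx => H.
  suff: (1 + count_mem c w)%N == 0%N by [].
  apply: H; apply/mapP; exists c => //=; by rewrite eqxx.
have w0 : (0 < size w)%N.
  case: w nonzero_idx {wk wA} => // /allPn[d /mapP[i _ ->]]; by rewrite eqxx.
have size_s p : (p < size w)%N ->
    #|` slab (iota 0 k) (hgt w p) (nth 0%N w p)| = k.+1.
  by move=> pw; rewrite card_slab ?iota_uniq ?size_iota ?wA.
have cap p q := @card_slabI (iota 0 k) w p q (iota_uniq 0 k) wk.
rewrite size_iota in cap.
have Ek : size (base (stair w)) = k by rewrite /= size_canon_base.
have uS : uniq (simps (stair w)).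
  rewrite /= /slabs /mkseq map_inj_in_uniq ?iota_uniq // => p q.
  rewrite !mem_iota /= !add0n => pw qw E; apply/eqP; rewrite eqn_leq.
  apply/andP; split; rewrite leqNgt; apply/negP => lt.
    have [] := cap q p; first by rewrite lt.
    by rewrite E fsetIid size_s ?ltnn.
  have [] := cap p q; first by rewrite lt.
  by rewrite E fsetIid size_s ?ltnn.
split.
- split=> //.
  + move=> s /mem_slabs[p pw ->]; rewrite Ek size_s //; split=> //.
    by rewrite stair_points //; apply/aff_free_indep/slab_aff_free => //; exact: wA.
  + by move=> l; apply: stair_labels.
  + move=> x; split=> [/stair_polyhedron[b [t [b0 b1 lv ->]]]|[s /mem_slabs[p pw ->]]].
      have [p pw lp] := level_chain w0 b0 lv.
      exists (slab (iota 0 k) (hgt w p) (nth 0%N w p)); first exact: slabs_mem.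
      by apply/conv_stair => //; exists b, t.
    case/(conv_stair wk _ pw) => b [t [b0 b1 /andP[l1 l2] ->]].
    apply/stair_polyhedron; exists b, t; split=> //.
    by rewrite (le_trans _ l1) ?(le_trans l2) // level_le // => i _; exact: hgt_mono.
  + move=> s s' x /mem_slabs[p pw ->] /mem_slabs[q qw ->] xp xq.
    case: (ltngtP p q) => [lt|lt|E].
    * by apply: stair_meet => //; rewrite lt.
    * by rewrite fsetIC; apply: stair_meet => //; rewrite lt.
    * by subst q; rewrite fsetIid.
- move=> p q; rewrite /= size_mkseq => pqw; have /andP[pq qw] := pqw.
  rewrite !nth_slabs ?(ltn_trans pq) //  size_canon_base.
  by have [] := cap p q.
- split=> l /mapP[i]; rewrite Ek mem_iota /= add0n => ik ->.
    rewrite -nth0 nth_slabs // in_slab; apply/orP; right.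
    by rewrite mem_iota hgt0 /= ik.
  rewrite (nth_map 0%N) ?size_iota // nth_iota // add0n -hgt_size.
  rewrite -nth_last size_mkseq.
  case: (size w) w0 (@nth_slabs k w (size w).-1) (@hgt_next w) => // m _ -> // hn.
  by rewrite hn //; apply: slab_up; rewrite mem_iota.
Qed.

Lemma stair_canonical w : canonical (stair w).
Proof. by split; rewrite /= size_canon_base. Qed.

Lemma stair_LR w : all (mem (iota 0 k)) w -> LR_sequence (stair w) w.
Proof.
move=> wk; split; first by rewrite /= size_mkseq.
move=> p pw; exists (hgt w p (nth 0%N w p)); rewrite /= nth_slabs //.
by rewrite !in_slab /= mem_iota letter_lt // !eqxx orbT.
Qed.

End Prismatic.

(** * Uniqueness of the diagram with a given LR-sequence *)

Section Uniqueness.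
Variables (R : realFieldType) (N k : nat).
Hypotheses (kN : (k <= N)%N) (k0 : (0 < k)%N).

Local Notation canon_pt := (@canon_pt R N k).
Local Notation bary_pt := (@bary_pt R N k).
Local Notation level := (@level R k).
Local Notation stair := (@stair R N k).
Local Notation slab := (slab (iota 0 k)).

Definition meet_in_face (s s' : {fset nat * nat}) : Prop :=
  forall x, conv [seq canon_pt l | l <- enum_fset s] x ->
    conv [seq canon_pt l | l <- enum_fset s'] x ->
    conv [seq canon_pt l | l <- enum_fset (s `&` s')] x.

(** A simplex cannot contain an interior point of another one: this point would
    have to lie in the common face, but it lies in no proper face of the second
    simplex. Weights and heights are given by integers, up to a common
    factor. *)
Lemma slab_overlap h c g d (b : nat -> nat) (t : nat) :
  (c < k)%N -> (d < k)%N -> meet_in_face (slab h c) (slab g d) ->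
  (forall i, (i < k)%N -> (0 < b i)%N) ->
  (\sum_(i < k) h i * b i < t < \sum_(i < k) bump h c i * b i)%N ->
  (\sum_(i < k) g i * b i <= t <= \sum_(i < k) bump g d i * b i)%N ->
  slab h c = slab g d.
Proof.
move=> ck dk meet b0 /andP[lo up] /andP[lo' up'].
pose B := (\sum_(i < k) b i)%N.
have B0 : (0 < B)%N by rewrite /B (bigD1 (Ordinal k0)) //= addn_gt0 b0.
have BR : 0 < B%:R :> R by rewrite ltr0n.
pose beta i : R := (b i)%:R / B%:R; pose tau : R := t%:R / B%:R.
have lE f : level f beta = (\sum_(i < k) f i * b i)%:R / B%:R.
  rewrite natr_sum mulr_suml; apply: eq_bigr => i _.
  by rewrite natrM mulrA.
have beta1 : \sum_(i < k) beta i = 1.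
  by rewrite -mulr_suml -natr_sum divff // gt_eqF.
have beta_gt0 i : (i < k)%N -> 0 < beta i by move=> ik; rewrite divr_gt0 ?ltr0n ?b0.
have beta0 i : (i < k)%N -> 0 <= beta i by move=> /beta_gt0/ltW.
have scaled (m n : nat) : (m%:R / B%:R <= n%:R / B%:R :> R) = (m <= n)%N.
  by rewrite ler_pM2r ?invr_gt0 // ler_nat.
have : conv [seq canon_pt l | l <- enum_fset (slab h c `&` slab g d)] (bary_pt beta tau).
  by apply: meet; apply/conv_slab => //; exists beta, tau; split=> //;
     rewrite !lE !scaled ?lo' ?up' // ltnW //= ltnW.
case/conv_out => [l /fsetIP[+ _]|b' [t' [_ b1' E lv supp]]]; first exact: slab_lt.
have [|Et Eb] := bary_pt_inj kN k0 _ E; first by rewrite beta1.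
have lE' f : level f b' = level f beta by apply: eq_bigr => i _; rewrite Eb.
have cA : c \in iota 0 k by rewrite mem_iota.
have dA : d \in iota 0 k by rewrite mem_iota.
have sub : slab h c `<=` slab g d.
  apply/fsubsetP => l ls; apply: contraT => ns.
  have other l' : l' \in enum_fset (slab h c `&` slab g d) -> l' \in slab h c /\ l' != l.
    move=> /fsetIP[l's l's']; split=> //; apply: contraNneq ns => <- //.
  have [El|lt] := eqVneq l (c, (h c).+1).
    (* without the raised vertex, the face lies in the lower level *)
    have := (lv h).2; rewrite lE' -Et lE /tau scaled => H.
    suff: (t <= \sum_(i < k) h i * b i)%N by rewrite leqNgt lo.
    apply: H => l' /other[]; rewrite in_slab El => /orP[-> //|/andP[_ /eqP ->]] //.
  have Ell : l = (l.1, h l.1).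
    by move: ls; rewrite in_slab (negbTE lt) /= => /andP[_ /eqP <-]; case: (l).
  have [lc|lc] := eqVneq l.1 c.
    (* without the vertex under it, the face lies in the upper level *)
    have := (lv (bump h c)).1; rewrite lE' -Et lE /tau scaled => H.
    suff: (\sum_(i < k) bump h c i * b i <= t)%N by rewrite leqNgt up.
    apply: H => l' /other[]; rewrite in_slab => /orP[/eqP -> _|/andP[_ /eqP E'] ne].
      by rewrite /bump /= eqxx addn1.
    rewrite /bump E'; case: eqP => [l'c|_]; last by rewrite addn0.
    by case/eqP: ne; rewrite Ell lc -l'c -E'; case: (l').
  (* the face misses the mast of l *)
  have lk : (l.1 < k)%N := slab_lt ck ls.
  have [|l' /other[l's ne] El'] := supp l.1; first by rewrite -Eb // gt_eqF ?beta_gt0.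
  move: l's; rewrite in_slab => /orP[/eqP Ec|/andP[_ /eqP E']].
    by move: lc; rewrite -El' Ec eqxx.
  by case/eqP: ne; rewrite Ell -El' -E'; case: (l').
apply/eqP; rewrite eqEfcard sub /= !card_slab ?iota_uniq //.
Qed.

Lemma sum_bump h c (b : nat -> nat) : (c < k)%N ->
  (\sum_(i < k) bump h c i * b i = \sum_(i < k) h i * b i + b c)%N.
Proof.
move=> ck; rewrite /bump (eq_bigr (fun i : 'I_k => h i * b i + (i == Ordinal ck) * b i))%N.
  rewrite big_split /=; congr addn; rewrite (bigD1 (Ordinal ck)) //= eqxx mul1n.
  by rewrite big1 ?addn0 // => i /negbTE ->.
by move=> i _; rewrite mulnDl.
Qed.

(** Over the centre of the deck both simplices are the same interval, and its
    midpoint is an interior point. *)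
Lemma slab_same_size h c g d : (c < k)%N -> (d < k)%N ->
  meet_in_face (slab h c) (slab g d) ->
  (\sum_(i < k) h i = \sum_(i < k) g i)%N -> slab h c = slab g d.
Proof.
move=> ck dk meet E.
have two f : (\sum_(i < k) f i * 2 = 2 * \sum_(i < k) f i)%N.
  by rewrite -big_distrl mulnC.
have two' f e : (e < k)%N -> (\sum_(i < k) bump f e i * 2 = 2 * \sum_(i < k) f i + 2)%N.
  by move=> ek; rewrite -two; exact: (sum_bump f (fun=> 2%N)).
apply: (slab_overlap (b := fun=> 2%N) (t := (2 * \sum_(i < k) h i).+1) ck dk meet) => //.
  by rewrite two' // two; lia.
by rewrite two' // two E; lia.
Qed.

(** Two simplices on the same side of a common vertical facet overlap near that
    facet, where the raised mast [c] has a large weight. *)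
Lemma slab_vertical h c g i : (c < k)%N -> (i < k)%N -> i != c ->
  meet_in_face (slab h c) (slab g c) ->
  (forall j, (j < k)%N -> j != i -> h j = g j) -> (h i < g i)%N ->
  slab h c = slab g c.
Proof.
move=> ck ik ic meet same lt.
pose b j := if j == c then (g i - h i).+1 else 1%N.
have gE : (\sum_(j < k) g j * b j = \sum_(j < k) h j * b j + (g i - h i))%N.
  rewrite (bigD1 (Ordinal ik)) //= [in RHS](bigD1 (Ordinal ik)) //=.
  rewrite (eq_bigr (fun j : 'I_k => h j * b j)%N) => [|j ji].
    by rewrite /b (negbTE ic); lia.
  by rewrite same.
apply: (slab_overlap (b := b) (t := \sum_(j < k) h j * b j + (g i - h i))%N ck ck meet).
- by move=> j _; rewrite /b; case: ifP.
- by rewrite sum_bump // /b eqxx; lia.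
- by rewrite sum_bump // gE leqnn leq_addr.
Qed.

Lemma fsetI_loss (s s' : {fset nat * nat}) x y : #|` s| = #|` s `&` s'|.+1 ->
  x \in s -> y \in s -> x \notin s' -> y \notin s' -> x = y.
Proof.
move=> E xs ys xs' ys'.
have : #|` s `\` s'| = 1%N.
  by have := cardfsID s' s; rewrite E; lia.
move/eqP/cardfs1P => [z Ez].
have xz : x \in s `\` s' by rewrite in_fsetD xs' xs.
have yz : y \in s `\` s' by rewrite in_fsetD ys' ys.
by move: xz yz; rewrite Ez !in_fset1 => /eqP -> /eqP ->.
Qed.

(** Passing a common facet: a vertical facet is impossible, and otherwise the
    masts have the same heights in the facet. Hence the path goes up, unless
    the second simplex fills the same interval as the first one over the centre
    of the deck, or the interval below it. *)
Lemma slab_adjacent h c g d : (c < k)%N -> (d < k)%N ->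
  meet_in_face (slab h c) (slab g d) -> meet_in_face (slab g d) (slab h c) ->
  #|` slab h c `&` slab g d| = k ->
  [\/ forall i, (i < k)%N -> g i = bump h c i,
      (\sum_(i < k) h i = \sum_(i < k) g i)%N |
      (\sum_(i < k) h i = (\sum_(i < k) g i).+1)%N].
Proof.
move=> ck dk meet meet' cap.
have card e f : (e < k)%N -> #|` slab f e| = k.+1.
  by move=> ek; rewrite card_slab ?iota_uniq ?size_iota ?mem_iota.
have loss x y := @fsetI_loss (slab h c) (slab g d) x y.
have loss' x y := @fsetI_loss (slab g d) (slab h c) x y.
rewrite [_ `&` slab h c]fsetIC in loss'.
rewrite cap !card // in loss loss'.
have inA i : (i < k)%N -> i \in iota 0 k by rewrite mem_iota.
have low f e i : (i < k)%N -> (i, f i) \in slab f e by move=> ik; apply/slab_low/inA.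
have top f e : (e, (f e).+1) \in slab f e by rewrite in_slab eqxx.
have onmast f e i t : (i < k)%N -> ((i, t) \in slab f e) =
    ((t == f i) || ((i == e) && (t == (f i).+1))).
  move=> ik; rewrite in_slab /= inA //= orbC; congr (_ || _).
  by rewrite xpair_eqE; case: eqP => //= ->.
have differ : slab h c <> slab g d.
  by move=> E; move: cap; rewrite -E fsetIid card //; lia.
have [/existsP[i /forallP miss]|] := boolP [exists i : 'I_k,
    [forall l : slab h c `&` slab g d, (val l).1 != i]].
  have ik := ltn_ord i.
  have miss1 t : (nat_of_ord i, t) \in slab h c -> (nat_of_ord i, t) \notin slab g d.
    move=> l1; apply/negP => l2.
    have l12 : (nat_of_ord i, t) \in slab h c `&` slab g d by apply/fsetIP.
    by have := miss [` l12]; rewrite /= eqxx.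
  have miss2 t : (nat_of_ord i, t) \in slab g d -> (nat_of_ord i, t) \notin slab h c.
    by move=> l2; apply/negP => /miss1; rewrite l2.
  have ic : nat_of_ord i != c.
    apply/eqP => E; have tp : (nat_of_ord i, (h i).+1) \in slab h c by rewrite E top.
    have [] := loss _ _ erefl (low h c i ik) tp (miss1 _ (low h c i ik)) (miss1 _ tp).
    by lia.
  have id : nat_of_ord i != d.
    apply/eqP => E; have tp : (nat_of_ord i, (g i).+1) \in slab g d by rewrite E top.
    have [] := loss' _ _ erefl (low g d i ik) tp (miss2 _ (low g d i ik)) (miss2 _ tp).
    by lia.
  have keep l : l \in slab h c -> l.1 != i -> l \in slab g d.
    move=> ls li; apply: contraT => ls'.
    have E := loss _ _ erefl ls (low h c i ik) ls' (miss1 _ (low h c i ik)).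
    by rewrite E eqxx in li.
  have c1 := keep _ (low h c c ck); have c2 := keep _ (top h c).
  rewrite /= eq_sym ic !onmast // in c1 c2.
  have {c1 c2} /andP[/eqP Ec /eqP hgc] : (c == d) && (h c == g c).
    move: (c1 isT) (c2 isT); case: (c == d) => /=; lia.
  have same j : (j < k)%N -> j != i -> h j = g j.
    move=> jk ji; have := keep _ (low h c j jk) ji; rewrite onmast // -Ec.
    by case: (eqVneq j c) => [-> _|_ /=]; [exact: hgc | rewrite orbF => /eqP].
  case: differ; subst d; case: (ltngtP (h i) (g i)) => [lt|lt|E].
  - exact: (slab_vertical ck ik).
  - by apply/esym/(slab_vertical ck ik) => // j jk ji; rewrite same.
  - by have := miss1 _ (low h c i ik); rewrite onmast // E eqxx.
rewrite negb_exists => /forallP hit.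
have common i : (i < k)%N -> exists t,
    ((t == h i) || ((i == c) && (t == (h i).+1))) &&
    ((t == g i) || ((i == d) && (t == (g i).+1))).
  move=> ik; have := hit (Ordinal ik); rewrite negb_forall => /existsP[[[j t] /= /fsetIP[l1 l2]]].
  rewrite negbK => /eqP /= E; exists t.
  by rewrite E !onmast // in l1 l2; rewrite l1 l2.
have ext f1 f2 : (forall i, (i < k)%N -> f1 i = f2 i) ->
    (\sum_(i < k) f1 i = \sum_(i < k) f2 i)%N.
  by move=> E; apply: eq_bigr => i _; rewrite E.
have sb f e : (e < k)%N -> (\sum_(i < k) bump f e i = (\sum_(i < k) f i).+1)%N.
  move=> ek; have := sum_bump f (fun=> 1%N) ek.
  rewrite (eq_bigr (fun i : 'I_k => bump f e i)) => [->|i _]; last by rewrite muln1.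
  by rewrite addn1; congr _.+1; apply: eq_bigr => i _; rewrite muln1.
have [Ecd|ncd] := eqVneq c d.
  have off i : (i < k)%N -> i != c -> h i = g i.
    move=> ik ic; have [t] := common i ik; rewrite -Ecd (negbTE ic) /= !orbF.
    by case/andP => /eqP <- /eqP.
  have [t] := common c ck; rewrite -Ecd eqxx /= => Ht.
  have : [|| g c == h c, g c == (h c).+1 | h c == (g c).+1] by lia.
  case/or3P => /eqP E.
  - case: differ; rewrite -Ecd; apply: slab_ext; last exact: inA.
    move=> i; rewrite mem_iota => /andP[_ ik].
    by case: (eqVneq i c) => [->|/off->].
  - constructor 1 => i ik; rewrite /bump; case: (eqVneq i c) => [->|ne].
      by rewrite E addn1.
    by rewrite addn0 off.
  - constructor 3; rewrite -(sb g c ck); apply: ext => i ik; rewrite /bump.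
    case: (eqVneq i c) => [->|ne]; first by rewrite E addn1.
    by rewrite addn0 off.
have off i : (i < k)%N -> i != c -> i != d -> h i = g i.
  move=> ik ic id; have [t] := common i ik; rewrite (negbTE ic) (negbTE id) /= !orbF.
  by case/andP => /eqP <- /eqP.
have hc : (g c == h c) || (g c == (h c).+1).
  by have [t] := common c ck; rewrite eqxx (negbTE ncd) /=; lia.
have hd : (h d == g d) || (h d == (g d).+1).
  by have [t] := common d dk; rewrite eqxx [d == c]eq_sym (negbTE ncd) /=; lia.
have bumpE (f : nat -> nat) e i : bump f e i = if i == e then (f i).+1 else f i.
  by rewrite /bump; case: eqP; rewrite ?addn1 ?addn0.
have split_at (P : nat -> Prop) : P c -> P d ->
    (forall i, (i < k)%N -> i != c -> i != d -> P i) -> forall i, (i < k)%N -> P i.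
  move=> Pc Pd Po i ik; have [->//|ic] := eqVneq i c.
  by have [->//|id] := eqVneq i d; apply: Po.
case/orP: hc => /eqP hc; case/orP: hd => /eqP hd.
- by constructor 2; apply: ext; apply: split_at => //; rewrite ?hc.
- constructor 3; rewrite -(sb g d dk); apply: ext; apply: split_at.
  + by rewrite bumpE (negbTE ncd).
  + by rewrite bumpE eqxx.
  + by move=> i ik ic id; rewrite bumpE (negbTE id) off.
- constructor 1; apply: split_at.
  + by rewrite bumpE eqxx.
  + by rewrite bumpE eq_sym (negbTE ncd).
  + by move=> i ik ic id; rewrite bumpE (negbTE ic) off.
- constructor 2; apply: succn_inj; rewrite -(sb h c ck) -(sb g d dk); apply: ext.
  apply: split_at.
  + by rewrite !bumpE eqxx (negbTE ncd).
  + by rewrite !bumpE eqxx eq_sym (negbTE ncd).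
  + by move=> i ik ic id; rewrite !bumpE (negbTE ic) (negbTE id) off.
Qed.

(** Full-dimensional simplices touch every mast: over a deck with one vertex
    less the points would span one dimension less. *)
Lemma aff_indep_hits (s : {fset nat * nat}) i :
  (forall l, l \in s -> l.1 < k)%N -> #|` s| = k.+1 ->
  aff_indep [seq canon_pt l | l <- enum_fset s] -> (i < k)%N ->
  exists2 l, l \in s & l.1 = i.
Proof.
move=> sk card ind ik.
have [/hasP[l ls /eqP <-]|/hasPn no] := boolP (has (fun l => l.1 == i) (enum_fset s)).
  by exists l.
exfalso; case Es : (enum_fset s) card ind no => [|l0 r] //= [sr] ind no.
have l0s : l0 \in s by rewrite -[_ \in s]/(l0 \in enum_fset s) Es mem_head.
have l0k := sk _ l0s; have l0i := no l0 (mem_head _ _).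
pose js := [seq j <- iota 0 k | (j != i) && (j != l0.1)].
pose X : seq 'rV[R]_N := canon_dir R N k :: [seq unit_vec N R j - unit_vec N R l0.1 | j <- js].
have : (\dim <<differences [seq canon_pt l | l <- l0 :: r]>> <= \dim <<X>>)%N.
  apply/dimvS/span_subvP => _ /mapP[_ /mapP[l lr ->] ->].
  have lk : (l.1 < k)%N.
    by apply: sk; rewrite -[_ \in s]/(l \in enum_fset s) Es inE lr orbT.
  have li := no l; rewrite inE lr orbT in li.
  have -> : canon_pt l - canon_pt l0 = (unit_vec N R l.1 - unit_vec N R l0.1)
      + (l.2%:R - l0.2%:R) *: canon_dir R N k.
    by rewrite scalerBl opprD addrACA.
  apply: memvD; last by apply/memvZ/memv_span/mem_head.
  have [->|ne] := eqVneq l.1 l0.1; first by rewrite subrr mem0v.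
  apply: memv_span; rewrite inE; apply/orP; right; apply/mapP; exists l.1 => //.
  by rewrite mem_filter li // ne mem_iota.
move/eqnP: ind => ->; rewrite /differences !size_map /= sr => /leq_trans/(_ (dim_span X)).
rewrite /X /= size_map => lt.
have : (size (l0.1 :: i :: js) <= size (iota 0 k))%N.
  apply: uniq_leq_size => /=.
    rewrite inE (negbTE l0i) !mem_filter !eqxx /= andbF /= filter_uniq ?iota_uniq //.
  move=> j; rewrite !inE => /or3P[/eqP ->|/eqP ->|]; rewrite ?mem_iota //.
  by rewrite mem_filter => /andP[_]; rewrite mem_iota.
by rewrite size_iota /=; lia.
Qed.

(** There are k + 1 vertices on k masts, and each mast has at least one of them;
    so the mast with two of them leaves only one for each of the others. *)
Lemma simplex_shape (s : {fset nat * nat}) c t :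
  (forall l, l \in s -> l.1 < k)%N -> #|` s| = k.+1 ->
  aff_indep [seq canon_pt l | l <- enum_fset s] ->
  (c, t) \in s -> (c, t.+1) \in s -> exists h, s = slab h c.
Proof.
move=> sk card ind c1 c2; have ck : (c < k)%N := sk _ c1.
pose on i := nth (c, t) (enum_fset s) (find (fun l => l.1 == i) (enum_fset s)).
pose h i := if i == c then t else (on i).2.
have onE i : (i < k)%N -> (i, (on i).2) \in s.
  move=> ik; have [l ls li] := aff_indep_hits sk card ind ik.
  have hs : has (fun l => l.1 == i) (enum_fset s).
    by apply/hasP; exists l => //; apply/eqP.
  have /eqP E := nth_find (c, t) hs; rewrite -[X in (X, _)]E -surjective_pairing.
  by rewrite -[_ \in s]/(on i \in enum_fset s) mem_nth // -has_find.
exists h; apply/esym/eqP; rewrite eqEfcard card card_slab ?iota_uniq ?mem_iota //.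
rewrite size_iota leqnn andbT; apply/fsubsetP => l; rewrite in_slab /h eqxx.
case/orP=> [/eqP -> //|]; rewrite mem_iota /= add0n => /andP[lk /eqP El].
rewrite [l]surjective_pairing El; case: eqP => [-> //|_]; exact: onE.
Qed.

Lemma sum_hgt w p : all (mem (iota 0 k)) w -> (p <= size w)%N ->
  (\sum_(i < k) hgt w p i = p)%N.
Proof.
move=> wk; elim: p => [|p IH] pw; first by rewrite big1 // => i _; rewrite hgt0.
have pk := letter_lt wk pw.
have := sum_bump (hgt w p) (fun=> 1%N) pk.
rewrite (eq_bigr (fun i : 'I_k => hgt w p.+1 i)) => [->|i _]; last by rewrite muln1 hgt_next.
by rewrite addn1 (eq_bigr (fun i : 'I_k => hgt w p i)) => [|i _]; rewrite ?muln1 // IH // ltnW.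
Qed.

(** The LR-sequence prescribes the raised mast of each simplex, and the
    geometry prescribes the rest: the first simplex stands on the deck, and each
    further one is put on the top of its predecessor. *)
Theorem LR_determines (D : prism R N) w :
  canonical D -> size (base D) = k -> prismatic_diagram D -> LR_sequence D w ->
  all (mem (iota 0 k)) w /\ D = stair w.
Proof.
move=> [_ Eb Ed] sb [[_ sh _ _ _] H] [sw LR]; rewrite sb -/(canon_base R N k) in Eb.
rewrite sb -/(canon_dir R N k) in Ed; rewrite sb in sh.
have base_dir : forall hs ss, heights D = hs -> simps D = ss ->
    D = Prism (canon_base R N k) (canon_dir R N k) hs ss.
  by case: (D) Eb Ed => b v hs ss /= -> -> _ _ <- <-.
case: ifP H => [/allP z S0|/negbT nonzero_idx].
  have w0 : w = [::] by apply: size0nil; rewrite sw S0.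
  rewrite w0; split=> //; apply: base_dir => //.
  apply: (@eq_from_nth _ 0%N); rewrite ?size_map ?size_iota // sh => i ik.
  rewrite (nth_map 0%N) ?size_iota //=; apply/eqP/z/mem_nth.
  by rewrite sh.
case=> [[T1 T2 T3 T4 T5] dual [deck_head _]].
have lab s l : s \in simps D -> l \in s -> (l.1 < k)%N.
  move=> sD ls; suff : on_mast D l by rewrite /on_mast sb => /andP[].
  by apply/T2; exists s.
have ptsE s : s \in simps D -> points D s = [seq canon_pt l | l <- enum_fset s].
  by move=> sD; apply: points_canonical => // l; apply: lab sD.
have meet s s' : s \in simps D -> s' \in simps D -> meet_in_face s s'.
  move=> sD s'D x; have := T4 s s' x sD s'D; rewrite (ptsE s) // (ptsE s') //.
  rewrite (points_canonical (k := k) (D := D)) // => l /fsetIP[+ _]; exact: lab sD.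
have shape p : (p < size w)%N -> nth fset0 (simps D) p \in simps D /\
    exists h, nth fset0 (simps D) p = slab h (nth 0%N w p).
  move=> pw; have sD : nth fset0 (simps D) p \in simps D by rewrite mem_nth // -sw.
  split=> //; have [t [t1 t2]] := LR p pw; have [c ind] := T1 _ sD.
  rewrite sb in c; rewrite ptsE // in ind.
  by apply: simplex_shape t1 t2 => // l; apply: lab.
have wk : all (mem (iota 0 k)) w.
  apply/(all_nthP 0%N) => p pw; have [sD _] := shape p pw.
  by have [t [t1 _]] := LR p pw; rewrite /= mem_iota /=; exact: lab sD t1.
have kw p : (p < size w)%N -> (nth 0%N w p < k)%N by exact: letter_lt wk p.
have ext h g p : (p < size w)%N -> (forall i, (i < k)%N -> h i = g i) ->
    slab h (nth 0%N w p) = slab g (nth 0%N w p).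
  move=> pw E; apply: slab_ext; last by rewrite mem_iota kw.
  by move=> i; rewrite mem_iota => /andP[_]; exact: E.
have nthE p : (p < size w)%N -> nth fset0 (simps D) p = slab (hgt w p) (nth 0%N w p).
  elim/ltn_ind: p => -[|p] IH pw.
    have [sD [h Eh]] := shape 0%N pw; rewrite Eh; apply: ext => // i ik.
    have : (i, 0%N) \in slab h (nth 0%N w 0).
      rewrite -Eh nth0; apply: deck_head; apply/mapP; exists i => //.
      by rewrite mem_iota sb.
    by rewrite hgt0 in_slab => /orP[/eqP[]|/andP[_ /eqP]].
  have pw' := ltnW pw; have [sD _] := shape p pw'; have Ep := IH p (leqnn _) pw'.
  have [s'D [g Eg]] := shape p.+1 pw.
  have cap : #|` nth fset0 (simps D) p `&` nth fset0 (simps D) p.+1| = k.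
    by rewrite -sb; apply/dual => //; rewrite leqnn -sw.
  have m1 := meet _ _ sD s'D; have m2 := meet _ _ s'D sD.
  (* a simplex over the same interval as an earlier one coincides with it *)
  have again q : (q <= p)%N ->
      (\sum_(i < k) hgt w q i = \sum_(i < k) g i)%N -> False.
    move=> qp E; have qw : (q < size w)%N by lia.
    have Eq := IH q qp qw; have [qD _] := shape q qw.
    have mq := meet _ _ qD s'D; rewrite Eq Eg in mq.
    have := slab_same_size (kw _ qw) (kw _ pw) mq E; rewrite -Eq -Eg => /eqP.
    by rewrite nth_uniq -?sw //; lia.
  rewrite Ep Eg in cap m1 m2; rewrite Eg.
  case: (slab_adjacent (kw _ pw') (kw _ pw) m1 m2 cap) => [up|E|E].
  - by apply: ext => // i ik; rewrite up // hgt_next.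
  - by case: (again p).
  - rewrite sum_hgt // in E; last exact: ltnW.
    (* below the first simplex there is no room for a second one *)
    case: (posnP p) => [p0|p0]; first by rewrite p0 in E.
    case: (again p.-1); first exact: leq_pred.
    rewrite sum_hgt //; first by rewrite [in LHS]E.
    exact: leq_trans (leq_pred _) (ltnW pw').
have ES : simps D = slabs (iota 0 k) w.
  apply: (@eq_from_nth _ fset0); first by rewrite size_mkseq.
  by rewrite -sw => p pw; rewrite nthE // nth_slabs.
split=> //; apply: base_dir => //; apply: (@eq_from_nth _ 0%N).
  by rewrite sh size_map size_iota.
rewrite sh => i ik; have w0 : (0 < size w)%N.
  have on0 : on_mast D (0%N, 0%N) by rewrite /on_mast sb k0.
  have /T2[s sD _] := on0; move: sD; rewrite sw; by case: (simps D).
have tops t : (t <= nth 0 (heights D) i)%N = (t <= count_mem i w)%N.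
  have := stair_on_mast R N k w (i, t); rewrite /= ik /= => <-.
  have -> : (t <= nth 0 (heights D) i)%N = on_mast D (i, t) by rewrite /on_mast sb ik.
  apply/idP/idP => [/T2|/(stair_labels R N wk _ w0)] H.
    by apply/(stair_labels R N wk _ w0); rewrite /= -ES.
  by apply/T2; rewrite ES.
rewrite (nth_map 0%N) ?size_iota // nth_iota // add0n.
by apply/eqP; rewrite eqn_leq tops leqnn -tops leqnn.
Qed.

End Uniqueness.

(** The raised mast is the only one with two labels. *)
Lemma slab_letter_inj (k c d : nat) (h g : nat -> nat) :
  (c < k)%N -> slab (iota 0 k) h c = slab (iota 0 k) g d -> c = d.
Proof.
move=> ck E; have c1 : (c, h c) \in slab (iota 0 k) g d by rewrite -E slab_low // mem_iota.
have c2 : (c, (h c).+1) \in slab (iota 0 k) g d by rewrite -E in_slab eqxx.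
move: c1 c2; rewrite !in_slab /=.
by case/orP=> [/eqP[]//|/andP[_ /eqP E1]] /orP[/eqP[]//|/andP[_ /eqP]]; lia.
Qed.

Lemma stair_inj (R : realFieldType) (N k : nat) w w' :
  all (mem (iota 0 k)) w -> all (mem (iota 0 k)) w' ->
  stair R N k w = stair R N k w' -> w = w'.
Proof.
move=> wk wk' [_ E]; have sE : size w = size w'.
  by have := congr1 size E; rewrite !size_mkseq.
apply: (@eq_from_nth _ 0%N) => // p pw.
have := congr1 (fun s => nth fset0 s p) E; rewrite !nth_slabs -?sE //.
by apply: slab_letter_inj; exact: (letter_lt wk pw).
Qed.

(** * Flags *)

Section Flags.
Variables (R : realFieldType) (n : nat).

(** The letters of a block are indices in {0, ..., n-1}, whereas a diagram
    numbers its own masts from 0 on; hence the positions in the active set. *)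
Definition stair_flag (bs : seq (seq nat * seq nat)) : flag R n :=
  [seq (stair R n (size b.1) [seq index c b.1 | c <- b.2], b.1) | b <- bs].

Lemma proper_block_stair b : proper_block n b ->
  [/\ (size b.1 <= n)%N, (0 < size b.1)%N &
      all (mem (iota 0 (size b.1))) [seq index c b.1 | c <- b.2]].
Proof.
move=> [uA A2 sA sw]; split.
- by rewrite -(size_iota 0 n); exact: uniq_leq_size.
- exact: ltnW.
- by apply/allP => _ /mapP[c cw ->]; rewrite /= mem_iota index_mem sw.
Qed.

Lemma stage_stair_flag bs p : (p < size bs)%N ->
  stage (stair_flag bs) p =
  let b := nth ([::], [::]) bs p in
  (stair R n (size b.1) [seq index c b.1 | c <- b.2], b.1).
Proof. by move=> pb; rewrite /stage (nth_map ([::], [::])). Qed.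

(** Each stage is determined by its LR-sequence, and the staircase exists. *)
Lemma is_TP alpha (F : flag R n) : readable n alpha ->
  is_T alpha F <-> F = stair_flag (cf_blocks n alpha).
Proof.
move=> /readable_blocks[_ _ proper _].
have properp p : (p < size (cf_blocks n alpha))%N ->
    proper_block n (nth ([::], [::]) (cf_blocks n alpha) p).
  by move=> pb; apply: proper; exact: mem_nth.
split=> [[ES H]|->].
  have sF : size F = size (cf_blocks n alpha).
    by have := congr1 size ES; rewrite !size_map.
  pose d : prism R n * seq nat := (Prism [::] 0 [::] [::], [::]).
  apply: (@eq_from_nth _ d) => [|p pF]; first by rewrite size_map.
  have := H p pF; rewrite -[nth d F p]/(stage F p).
  rewrite -[nth d (stair_flag _) p]/(stage (stair_flag (cf_blocks n alpha)) p).
  rewrite stage_stair_flag -?sF //=.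
  have : (stage F p).2 = (nth ([::], [::]) (cf_blocks n alpha) p).1.
    by rewrite /stage -(nth_map d [::]) // ES (nth_map ([::], [::])) // -sF.
  rewrite sF in pF; have [kn k0 _] := proper_block_stair (properp p pF).
  case: (stage F p) => T S /= -> [pT cT sT LT]; congr (_, _).
  by have [] := LR_determines kn k0 cT sT pT LT.
split=> [|p]; first by rewrite -map_comp; exact: eq_map.
rewrite size_map => pb; rewrite stage_stair_flag //=.
have [kn k0 wk] := proper_block_stair (properp p pb).
split; [exact: stair_prismatic | exact: stair_canonical | | exact: stair_LR].
by rewrite /= size_canon_base.
Qed.

Lemma stair_flag_canonical alpha : (1 < n)%N -> readable n alpha ->
  canonical_flag_diagram (stair_flag (cf_blocks n alpha)) /\
  size (stair_flag (cf_blocks n alpha)) = n.-1.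
Proof.
move=> n2 /readable_blocks[sz [w [bs E]] proper sorted_A].
split; last by rewrite size_map.
split; last by rewrite /first_prism stage_stair_flag ?E //; apply: stair_canonical;
  rewrite /= size_iota.
split.
- by rewrite E.
- move=> p; rewrite size_map => pb; rewrite stage_stair_flag //=.
  have [kn k0 wk] := proper_block_stair (proper _ (mem_nth ([::], [::]) pb)).
  by split; [exact: stair_prismatic | rewrite size_canon_base].
- by rewrite /first_prism stage_stair_flag ?E //= size_canon_base size_iota.
- by rewrite -map_comp; exact: sorted_A.
Qed.

Lemma stair_flag_inj alpha beta : readable n alpha -> readable n beta ->
  stair_flag (cf_blocks n alpha) = stair_flag (cf_blocks n beta) -> alpha = beta.
Proof.
move=> ra rb E; apply: (cf_blocks_inj ra rb).
have [_ _ pa _] := readable_blocks ra; have [_ _ pb _] := readable_blocks rb.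
have sE : size (cf_blocks n alpha) = size (cf_blocks n beta).
  by have := congr1 size E; rewrite !size_map.
apply: (@eq_from_nth _ ([::], [::])) => // p lt.
have := congr1 (fun F => stage F p) E; rewrite !stage_stair_flag -?sE //=.
have := pa _ (mem_nth ([::], [::]) lt); rewrite sE in lt.
have := pb _ (mem_nth ([::], [::]) lt).
case: (nth _ _ p) => B w' prB; case: (nth _ _ p) => A w prA E0.
have EA : A = B := congr1 snd E0; have Est := congr1 fst E0; rewrite /= in Est.
subst B; congr (_, _).
have [kn k0 wA] := proper_block_stair prA; have [_ _ wB] := proper_block_stair prB.
have Ew : [seq index c A | c <- w] = [seq index c A | c <- w'].
  exact: (stair_inj wA wB Est).
have sub : {subset w <= A} /\ {subset w' <= A} by case: prA; case: prB.
rewrite -[LHS](map_id_in (f := fun c => nth 0%N A (index c A))); last first.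
  by move=> c cw; rewrite nth_index //; exact: sub.1.
rewrite -[RHS](map_id_in (f := fun c => nth 0%N A (index c A))); last first.
  by move=> c cw; rewrite nth_index //; exact: sub.2.
by rewrite !(map_comp (nth 0%N A) (index^~ A)) Ew.
Qed.

End Flags.

(** * Nose stretching *)

(** The common combinatorial source of both constructions: the successive
    active sets together with the index that is raised. *)
Definition moves (bs : seq (seq nat * seq nat)) : seq (seq nat * nat) :=
  flatten [seq [seq (b.1, c) | c <- b.2] | b <- bs].

Fixpoint label_run (H : nat -> nat) (ms : seq (seq nat * nat)) :
    seq {fset nat * nat} :=
  if ms is (A, c) :: ms' then slab A H c :: label_run (bump H c) ms' else [::].

Definition final_height (H : nat -> nat) (ms : seq (seq nat * nat)) (i : nat) : nat :=
  (H i + count_mem i [seq m.2 | m <- ms])%N.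

Fixpoint proper_moves (A0 : seq nat) (ms : seq (seq nat * nat)) : Prop :=
  if ms is (A, c) :: ms' then
    [/\ {subset A <= A0}, uniq A, (1 < size A)%N & c \in A] /\ proper_moves A ms'
  else True.

Section LabelRuns.
Variables (R : realFieldType) (n : nat).

Lemma label_run_ext H H' ms : H =1 H' -> label_run H ms = label_run H' ms.
Proof.
elim: ms H H' => [|[A c] ms IH] H H' E //=; congr (_ :: _).
  by apply/fsetP => l; rewrite !in_slab !E.
by apply: IH => i; rewrite /bump E.
Qed.

Lemma final_height_cons H A c ms i : final_height H ((A, c) :: ms) i = final_height (bump H c) ms i.
Proof. by rewrite /final_height /bump /= eq_sym addnA. Qed.

Lemma label_run_cat H ms ms' :
  label_run H (ms ++ ms') = label_run H ms ++ label_run (final_height H ms) ms'.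
Proof.
elim: ms H => [|[A c] ms IH] H /=.
  by apply: label_run_ext => i; rewrite /final_height addn0.
rewrite IH; congr (_ :: _ ++ _); apply: label_run_ext => i.
by rewrite final_height_cons.
Qed.

Lemma label_run_block A H w :
  label_run H [seq (A, c) | c <- w] =
  mkseq (fun p => slab A (fun i => H i + hgt w p i)%N (nth 0%N w p)) (size w).
Proof.
elim: w H => [|c w IH] H //=; rewrite IH /mkseq /= -[1%N]addn0 iotaDl -map_comp.
congr (_ :: _).
  by apply/fsetP => l; rewrite !in_slab /hgt /= !addn0.
apply: eq_map => p /=; apply/fsetP => l; rewrite !in_slab /hgt /bump /= !addnA.
by rewrite ![c == _]eq_sym.
Qed.

Lemma count_index (A w : seq nat) c : {subset w <= A} -> c \in A ->
  count_mem (index c A) [seq index e A | e <- w] = count_mem c w.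
Proof.
move=> sw cA; rewrite count_map; apply: eq_in_count => e ew /=.
by apply/eqP/eqP => [E|-> //]; rewrite -(nth_index 0%N (sw e ew)) E nth_index.
Qed.

(** The concatenation adds to the heights of a stage the heights reached before;
    both count the letters of the words. *)
Lemma concat_labels_moves bs H : (forall b, b \in bs -> proper_block n b) ->
  concat_labels (stair_flag R n bs) H = label_run H (moves bs).
Proof.
elim: bs H => [|[A w] bs IH] H proper //=.
have [uA A2 sA sw] := proper _ (mem_head _ _); rewrite /= in sw.
have htsE p c : c \in A -> hgt [seq index c A | c <- w] p (index c A) = hgt w p c.
  by move=> cA; rewrite /hgt -map_take count_index // => e /mem_take /sw.
rewrite /moves /= label_run_cat IH => [|b bb]; last by apply: proper; rewrite inE bb orbT.
rewrite label_run_block; congr (_ ++ _).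
  rewrite /slabs /mkseq size_map -map_comp; apply/eq_in_map => p.
  rewrite mem_iota /= add0n => pw.
  have cA : nth 0%N w p \in A by apply/sw/mem_nth.
  rewrite (nth_map 0%N) //; apply/fsetP => l; rewrite in_slab.
  apply/imfsetP/orP => [[l' /=]|].
    rewrite in_slab => /orP[/eqP -> ->|/andP[+ /eqP El] ->].
      by left; rewrite /shift_label /= nth_index // htsE // addnS.
    rewrite mem_iota /= add0n => l'A; right.
    have := htsE p _ (mem_nth 0%N l'A); rewrite index_uniq // => <-.
    by rewrite mem_nth //= El.
  case=> [/eqP ->|/andP[lA /eqP El]].
    exists (index (nth 0%N w p) A, (hgt w p (nth 0%N w p)).+1).
      by rewrite /= in_slab htsE // eqxx.
    by rewrite /shift_label /= nth_index // addnS.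
  exists (index l.1 A, hgt w p l.1).
    rewrite /= in_slab; apply/orP; right.
    by rewrite mem_iota /= index_mem lA htsE /=.
  by rewrite /shift_label /= nth_index // -El; case: (l).
apply: label_run_ext => i; rewrite /final_height -map_comp map_id /raise.
case: ifP => iA; last first.
  by rewrite (count_memPn _) ?addn0 //; apply: contraFN iA => /sw.
rewrite (nth_map 0%N) ?size_iota ?index_mem // nth_iota ?index_mem // add0n.
by rewrite count_index.
Qed.

Lemma mast_height_moves bs i : (forall b, b \in bs -> proper_block n b) ->
  mast_height (stair_flag R n bs) i = final_height (fun=> 0%N) (moves bs) i.
Proof.
rewrite /mast_height => proper.
elim: bs (fun=> 0%N) proper => [|[A w] bs IH] H proper; first by rewrite /final_height addn0.
have [uA A2 sA sw] := proper _ (mem_head _ _); rewrite /= in sw.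
rewrite [LHS]IH => [|b bb]; last by apply: proper; rewrite inE bb orbT.
rewrite /final_height /moves /= map_cat count_cat addnA -map_comp map_id; congr (_ + _)%N.
rewrite /raise; case: ifP => iA; last first.
  by rewrite (count_memPn _) ?addn0 //; apply: contraFN iA => /sw.
rewrite (nth_map 0%N) ?size_iota ?index_mem // nth_iota ?index_mem // add0n.
by rewrite count_index.
Qed.

Lemma label_run_cover H ms i t : (H i < t)%N -> (t <= final_height H ms i)%N ->
  exists2 s, s \in label_run H ms & (i, t) \in s.
Proof.
elim: ms H => [|[A c] ms IH] H Ht; first by rewrite /final_height addn0 leqNgt Ht.
rewrite final_height_cons => tf; case: (ltnP (bump H c i) t) => lt.
  by have [s sm ts] := IH _ lt tf; exists s; rewrite // inE sm orbT.
exists (slab A H c); first by rewrite mem_head.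
rewrite in_slab; move: lt; rewrite /bump.
case: (eqVneq i c) => [E|_]; last by rewrite addn0 leqNgt Ht.
by rewrite addn1 => lt; apply/orP; left; rewrite xpair_eqE E eqxx eqn_leq -E lt.
Qed.

Lemma label_run_mem A0 H ms s l : proper_moves A0 ms -> s \in label_run H ms ->
  l \in s -> l.1 \in A0 /\ (l.2 <= final_height H ms l.1)%N.
Proof.
elim: ms A0 H => [|[A c] ms IH] A0 H //= [[sA uA A2 cA] pm].
rewrite inE final_height_cons => /orP[/eqP -> ls|sm ls]; last first.
  by have [lA lt] := IH _ _ pm sm ls; split=> //; exact: sA.
have [lA _ le] := slab_between cA ls; split; first exact: sA.
by rewrite (leq_trans le) // leq_addr.
Qed.

Lemma label_run_slab A0 H ms s : proper_moves A0 ms -> s \in label_run H ms ->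
  exists A c H', [/\ s = slab A H' c, {subset A <= A0} & c \in A].
Proof.
elim: ms A0 H => [|[A c] ms IH] A0 H //= [[sA uA A2 cA] pm].
rewrite inE => /orP[/eqP ->|sm]; first by exists A, c, H.
have [A' [c' [H' [-> sA' cA']]]] := IH _ _ pm sm.
by exists A', c', H'; split=> // i /sA' /sA.
Qed.

Lemma proper_moves_blocks bs A0 :
  (forall b, b \in bs -> proper_block n b) ->
  (if bs is b :: _ then {subset b.1 <= A0} else True) ->
  sorted (fun S S' => subseq S' S && (size S' < size S)%N) [seq b.1 | b <- bs] ->
  proper_moves A0 (moves bs).
Proof.
elim: bs A0 => [|[A w] bs IH] A0 //= proper sA0 srt.
have [uA A2 sA sw] := proper _ (mem_head _ _); rewrite /= in sw uA A2.
have rest : proper_moves A (moves bs).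
  apply: IH; first by move=> b bb; apply: proper; rewrite inE bb orbT.
    case: (bs) srt => [|b bs'] //= /andP[/andP[sub _] _]; exact: mem_subseq.
  exact: path_sorted srt.
suff H (w' : seq nat) A1 : {subset w' <= A} -> {subset A <= A1} ->
    proper_moves A1 ([seq (A, c) | c <- w'] ++ moves bs) by exact: H.
elim: w' A1 => [|c w' IHw] A1 sw' sA1 /=.
  case: (moves bs) rest => [|[B c] ms] //= [[sB uB B2 cB] pm].
  by split=> //; split=> // i /sB /sA1.
split; first by split=> //; apply: sw'; rewrite mem_head.
by apply: IHw => // e ew; apply: sw'; rewrite inE ew orbT.
Qed.

End LabelRuns.

Section FareyRuns.
Variable n : nat.

Fixpoint farey_run (V : nat -> 'rV[int]_n) (ms : seq (seq nat * nat)) :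
    seq {fset 'rV[int]_n} :=
  if ms is (A, c) :: ms'
  then ([fset V i | i in A] `|` [fset new_vertex A V])
         :: farey_run (replace_vertex A c V) ms'
  else [::].

Lemma farey_run_ext V V' ms : V =1 V' -> farey_run V ms = farey_run V' ms.
Proof.
elim: ms V V' => [|[A c] ms IH] V V' E //=.
have EN : new_vertex A V = new_vertex A V' by apply: eq_bigr => i _; rewrite E.
congr (_ :: _); last by apply: IH => i; rewrite /replace_vertex EN E.
by rewrite EN; congr (_ `|` _); apply: eq_imfset => // i; rewrite E.
Qed.

Lemma farey_run_stretch A c a V ms :
  farey_run V ([seq (A, e) | e <- nseq a c] ++ ms) =
  stretch A c a V ++ farey_run (iter a (replace_vertex A c) V) ms.
Proof. by elim: a V => [|a IH] V //=; rewrite IH -iterSr. Qed.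

Lemma farey_moves A q V alpha :
  farey A q V alpha = farey_run V (moves (blocks n A q [::] alpha)).
Proof.
elim: alpha A q V => [|[a|j] alpha IH] A q V //=.
rewrite IH -farey_run_stretch [in RHS]blocks_first [in LHS]blocks_first.
by rewrite /moves /= map_cat catA.
Qed.

Definition pairing (u : 'rV[int]_n) (psi : 'cV[int]_n) : int := (u *m psi) 0 0.

Lemma pairDr u psi1 psi2 : pairing u (psi1 + psi2) = pairing u psi1 + pairing u psi2.
Proof. by rewrite /pairing mulmxDr mxE. Qed.

Lemma pairNr u psi : pairing u (- psi) = - pairing u psi.
Proof. by rewrite /pairing mulmxN mxE. Qed.

Lemma pair_sum (A : seq nat) V psi :
  pairing (new_vertex A V) psi = \sum_(i <- A) pairing (V i) psi.
Proof. by rewrite /pairing /new_vertex mulmx_suml summxE. Qed.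

Lemma sum_delta (A : seq nat) c : uniq A -> c \in A ->
  \sum_(i <- A) ((i == c)%:R : int) = 1.
Proof.
move=> uA cA; rewrite (bigD1_seq c) //= eqxx big1 ?addr0 // => i /negbTE -> //.
Qed.

(** The state of the stretching: [phi i t] is the [t]-th vertex with index [i],
    and [H i] is the number of the current one. The current active vertices are
    part of a basis of the lattice, as they have a dual system. Every other
    vertex met so far is separated by a functional from the cone that they
    span. All later vertices lie in this cone, so they never coincide with an
    earlier one. *)
Definition stretched (A : seq nat) (phi : nat -> nat -> 'rV[int]_n)
    (H : nat -> nat) : Prop :=
  [/\ exists Phi : nat -> 'cV[int]_n, forall i j, i \in A -> j \in A ->
        pairing (phi i (H i)) (Phi j) = (i == j)%:R,
      forall i t, (i < n)%N -> (t <= H i)%N -> (i \in A /\ t = H i) \/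
        exists psi, (forall j, j \in A -> 0 <= pairing (phi j (H j)) psi) /\
                    pairing (phi i t) psi < 0
    & forall i t j u, (i < n)%N -> (j < n)%N -> (t <= H i)%N -> (u <= H j)%N ->
        phi i t = phi j u -> (i, t) = (j, u)].

Definition extend (A : seq nat) (c : nat) (phi : nat -> nat -> 'rV[int]_n)
    (H : nat -> nat) (i t : nat) : 'rV[int]_n :=
  if (i == c) && (t == (H c).+1) then new_vertex A (fun i => phi i (H i))
  else phi i t.

Lemma extend_old A c phi H i t : (t <= H i)%N -> extend A c phi H i t = phi i t.
Proof.
by move=> le; rewrite /extend; case: (eqVneq i c) => //= E;
   case: eqP => // Et; rewrite Et -E ltnn in le.
Qed.

Lemma extend_new A c phi H :
  extend A c phi H c (H c).+1 = new_vertex A (fun i => phi i (H i)).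
Proof. by rewrite /extend !eqxx. Qed.

Lemma extend_cur A c phi H i : extend A c phi H i (bump H c i) =
  replace_vertex A c (fun i => phi i (H i)) i.
Proof.
rewrite /bump /replace_vertex; case: (eqVneq i c) => [->|ne].
  by rewrite addn1 extend_new.
by rewrite addn0 extend_old.
Qed.

(** When an index becomes inactive, its vertex is separated from the remaining
    ones by a member of the dual system. *)
Lemma stretched_sub A A' phi H : {subset A' <= A} ->
  stretched A phi H -> stretched A' phi H.
Proof.
move=> sA [[Phi dual] sep inj]; split=> //.
  by exists Phi => i j /sA iA /sA jA; exact: dual.
move=> i t ik tH; case: (sep i t ik tH) => [[iA Et]|[psi [pos neg]]]; last first.
  by right; exists psi; split=> // j /sA; exact: pos.
case iA' : (i \in A'); [by left | right].
exists (- Phi i); split=> [j jA'|]; last by rewrite Et pairNr dual // eqxx.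
rewrite pairNr (dual j i (sA j jA') iA); case: (eqVneq j i) => [E|_] //.
by rewrite -E jA' in iA'.
Qed.

(** Replacing V_c by the sum of all active vertices subtracts the functional of
    [c] from the other members of the dual system. The old V_c is separated from
    the new cone by the difference of the functionals of another active index
    and of [c]. *)
Lemma stretched_step A c phi H : uniq A -> (1 < size A)%N -> c \in A ->
  {subset A <= iota 0 n} -> stretched A phi H ->
  stretched A (extend A c phi H) (bump H c).
Proof.
move=> uA A2 cA sA [[Phi dual] sep inj].
have An i : i \in A -> (i < n)%N by move/sA; rewrite mem_iota.
set V := fun i => phi i (H i); set W := new_vertex A V.
have pairW j : j \in A -> pairing W (Phi j) = 1.
  move=> jA; rewrite pair_sum -(sum_delta uA jA); apply: eq_big_seq => i iA.
  exact: dual.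
have curE i : i \in A -> extend A c phi H i (bump H c i) = if i == c then W else V i.
  by move=> iA; rewrite extend_cur.
have posW psi : (forall j, j \in A -> 0 <= pairing (V j) psi) -> 0 <= pairing W psi.
  move=> pos; rewrite pair_sum big_seq; apply: sumr_ge0; exact: pos.
have [e eA ec] : exists2 e, e \in A & e != c.
  case: A uA A2 cA {sep dual sA An V W pairW curE posW} => [|x [|y A]] //= /andP[xA _] _ _.
  case: (eqVneq x c) => [E|ne]; last by exists x; rewrite ?mem_head.
  by exists y; rewrite ?inE ?eqxx ?orbT // -E eq_sym; apply: contraNneq xA => ->; rewrite mem_head.
have new i t : (i < n)%N -> (t <= H i)%N -> phi i t <> W.
  move=> ik tH E; case: (sep i t ik tH) => [[iA Et]|[psi [pos neg]]]; last first.
    by have := posW psi pos; rewrite -E leNgt neg.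
  have same j : j \in A -> j = i.
    move=> jA; have : pairing W (Phi j) = (i == j)%:R by rewrite -dual // -Et E.
    by rewrite pairW //; case: (eqVneq i j).
  by rewrite (same e eA) (same c cA) eqxx in ec.
split.
- exists (fun j => if j == c then Phi c else Phi j - Phi c) => i j iA jA.
  rewrite curE //; have [Ej|jc] := eqVneq j c; have [Ei|ic] := eqVneq i c.
  + by rewrite pairW // Ei Ej eqxx.
  + by rewrite dual // Ej.
  + by rewrite pairDr pairNr !pairW // subrr Ei eq_sym (negbTE jc).
  + by rewrite pairDr pairNr !dual // (negbTE ic) subr0.
- move=> i t ik; rewrite /bump => tH.
  have sep' psi : (forall j, j \in A -> 0 <= pairing (V j) psi) ->
      forall j, j \in A -> 0 <= pairing (extend A c phi H j (bump H c j)) psi.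
    by move=> pos j jA; rewrite curE //; case: ifP => _; [exact: posW | exact: pos].
  case: (leqP t (H i)) => [le|lt]; last first.
    case: (eqVneq i c) tH => [E|_]; last by rewrite addn0 leqNgt lt.
    rewrite addn1 => le; left; split; first by rewrite E.
    by apply/eqP; rewrite eqn_leq le lt.
  rewrite extend_old //; case: (sep i t ik le) => [[iA Et]|[psi [pos neg]]]; last first.
    by right; exists psi; split=> //; exact: sep'.
  case: (eqVneq i c) tH => [E _|_ _]; last by left; rewrite addn0.
  right; exists (Phi e - Phi c); split=> [j jA|].
    rewrite curE // pairDr pairNr; case: (eqVneq j c) => [Ej|jc].
      by rewrite !pairW // subrr.
    by rewrite !dual // (negbTE jc) subr0; case: (_ == _).
  by rewrite Et pairDr pairNr !dual // E eqxx eq_sym (negbTE ec).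
- have old_or_new i t : (i < n)%N -> (t <= bump H c i)%N ->
      (t <= H i)%N \/ (i, t) = (c, (H c).+1).
    move=> ik; case: (leqP t (H i)) => [|lt]; first by left.
    rewrite /bump; case: (eqVneq i c) => [E|_]; last by rewrite addn0 leqNgt lt.
    by rewrite addn1 => le; right; congr (_, _) => //; apply/eqP; rewrite eqn_leq -E le lt.
  move=> i t j u ik jk /(old_or_new i t ik)[ti|[-> ->]] /(old_or_new j u jk)[uj|[-> ->]] //.
  + by rewrite !extend_old //; exact: inj.
  + by rewrite extend_new extend_old // => /new[].
  + by rewrite extend_new extend_old // => /esym/new[].
Qed.

(** The vertices V_i are linearly independent, and the new vertex has the sum of
    coordinates k > 1 while the others have the sum 1. *)
Lemma stretched_free (R : realFieldType) A c phi H (p : nat * nat -> 'rV[int]_n) :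
  uniq A -> (1 < size A)%N -> c \in A -> stretched A phi H ->
  (forall i, p (i, H i) = phi i (H i)) ->
  p (c, (H c).+1) = new_vertex A (fun i => phi i (H i)) ->
  aff_free (fun l => map_mx intr (p l) : 'rV[R]_n) (slab A H c).
Proof.
move=> uA A2 cA [[Phi dual] _ _] lowE topE.
have enum_s : perm_eq (slab A H c) ((c, (H c).+1) :: [seq (i, H i) | i <- A]).
  apply: uniq_perm; first exact: fset_uniq.
    rewrite /= map_inj_uniq ?uA ?andbT => [|i j []//].
    by apply/mapP => -[i _ [-> /eqP]]; rewrite eqn_leq ltnn.
  move=> l; rewrite [LHS]in_slab inE; congr (_ || _).
  apply/andP/mapP => [[lA /eqP El]|[i iA ->]] //.
  by exists l.1 => //; rewrite -El; case: (l).
pose rpair (u : 'rV[R]_n) j : R := (u *m map_mx intr (Phi j)) 0 0.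
have rpairE u j : rpair (map_mx intr u) j = (pairing u (Phi j))%:~R.
  by rewrite /rpair -map_mxM mxE.
have rdual i j : i \in A -> j \in A -> rpair (map_mx intr (p (i, H i))) j = (i == j)%:R.
  by move=> iA jA; rewrite rpairE lowE dual //; case: (i == j).
have rtop j : j \in A -> rpair (map_mx intr (p (c, (H c).+1))) j = 1.
  move=> jA; rewrite rpairE topE pair_sum (eq_big_seq (fun i => (i == j)%:R)).
    by rewrite sum_delta.
  by move=> i iA; rewrite dual.
move=> mu; rewrite !(perm_big _ enum_s) /= !big_cons !big_map => s0 p0.
set top := mu (c, (H c).+1) in s0 p0.
have muE j : j \in A -> mu (j, H j) = - top.
  move=> jA.
  have : top * rpair (map_mx intr (p (c, (H c).+1))) j +
      \sum_(i <- A) mu (i, H i) * rpair (map_mx intr (p (i, H i))) j = 0.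
    have /(congr1 (fun M : 'M[R]_1 => M 0 0)) :=
      congr1 (fun u => u *m map_mx intr (Phi j)) p0.
    rewrite mul0mx mulmxDl -scalemxAl mulmx_suml.
    rewrite [RHS]mxE [LHS]mxE [X in X + _]mxE summxE => E.
    rewrite -[RHS]E; congr (_ + _).
    by apply: eq_bigr => i _; rewrite -scalemxAl mxE.
  rewrite rtop // mulr1 (eq_big_seq (fun i => mu (i, H i) * (i == j)%:R)); last first.
    by move=> i iA; rewrite rdual.
  rewrite (bigD1_seq j) //= eqxx mulr1 big1 => [|i /negbTE ->]; last by rewrite mulr0.
  by rewrite addr0 addrC => /eqP; rewrite addr_eq0 => /eqP.
have top0 : top = 0.
  move: s0; rewrite (eq_big_seq (fun=> - top)) // big_const_seq count_predT iter_addr_0.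
  case: (size A) A2 => [|[|k]] // _; rewrite mulrS addrA subrr add0r mulNrn.
  by move/eqP; rewrite oppr_eq0 mulrn_eq0 /= => /eqP.
move=> l; rewrite in_slab => /orP[/eqP -> //|/andP[lA /eqP El]].
by rewrite [l]surjective_pairing El muE // top0 oppr0.
Qed.

(** A later move only adds a vertex with a new label. So one map [phi'], defined
    on all labels at the end, agrees with the vertices at each earlier time. *)
Lemma farey_run_history A0 phi H ms : proper_moves A0 ms ->
  {subset A0 <= iota 0 n} -> stretched A0 phi H ->
  exists phi', [/\ forall i t, (t <= H i)%N -> phi' i t = phi i t,
    farey_run (fun i => phi i (H i)) ms =
      [seq (fun l => phi' l.1 l.2) @` s | s <- label_run H ms],
    forall i t j u, (i < n)%N -> (j < n)%N ->
      (t <= final_height H ms i)%N -> (u <= final_height H ms j)%N ->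
      phi' i t = phi' j u -> (i, t) = (j, u)
  & forall (R : realFieldType) s, s \in label_run H ms ->
      aff_free (fun l : nat * nat => map_mx intr (phi' l.1 l.2) : 'rV[R]_n) s].
Proof.
elim: ms A0 phi H => [|[A c] ms IH] A0 phi H /=.
  move=> _ _ [_ _ inj]; exists phi; split=> // i t j u ik jk.
  by rewrite /final_height !addn0; exact: inj.
case=> [[sA uA A2 cA] pm] sA0 st0.
have sAn : {subset A <= iota 0 n} by move=> i /sA /sA0.
have st := stretched_sub sA st0.
have [phi' [old run inj free]] := IH _ _ _ pm sAn (stretched_step uA A2 cA sAn st).
have leb i : (H i <= bump H c i)%N by exact: leq_addr.
have topE : phi' c (H c).+1 = new_vertex A (fun i => phi i (H i)).
  by rewrite old ?extend_new // /bump eqxx addn1.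
have lowE i : phi' i (H i) = phi i (H i) by rewrite old ?extend_old.
exists phi'; split.
- by move=> i t tH; rewrite old ?extend_old // (leq_trans tH).
- congr (_ :: _); last first.
    by rewrite -run; apply: farey_run_ext => i; rewrite extend_cur.
  apply/fsetP => x; rewrite in_fsetU in_fset1; apply/orP/imfsetP => /=.
    case=> [/imfsetP[i /= iA ->]|/eqP ->].
      by exists (i, H i); rewrite ?slab_low //= lowE.
    by exists (c, (H c).+1); rewrite ?in_slab ?eqxx //= topE.
  move=> [l + ->]; rewrite in_slab => /orP[/eqP -> /=|/andP[lA /eqP ->]].
    by right; rewrite topE.
  by left; rewrite lowE; apply/imfsetP; exists l.1.
- by move=> i t j u ik jk; rewrite !final_height_cons; exact: inj.
- move=> R s; rewrite inE => /orP[/eqP ->|]; last exact: free.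
  exact: stretched_free st _ _.
Qed.

Lemma stretched_init : stretched (iota 0 n) (fun i _ => unit_vec n int i) (fun=> 0%N).
Proof.
have pairE i j : (i < n)%N -> (j < n)%N ->
    pairing (unit_vec n int i) (unit_vec n int j)^T = (i == j)%:R.
  move=> ik jk; rewrite /pairing mxE (bigD1 (Ordinal ik)) //= !mxE eqxx mul1r /=.
  rewrite big1 ?addr0 // => l li; rewrite !mxE.
  by rewrite (_ : (l == i :> nat) = false) ?mul0r //; apply/eqP => E;
     case/eqP: li; apply: val_inj.
split.
- exists (fun j => (unit_vec n int j)^T) => i j; rewrite !mem_iota => ik jk.
  exact: pairE.
- by move=> i t ik; rewrite leqn0 => /eqP ->; left; rewrite mem_iota.
- move=> i t j u ik jk; rewrite !leqn0 => /eqP -> /eqP -> E; congr (_, _).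
  have := pairE i i ik ik; rewrite {1}E pairE // eqxx eq_sym.
  by case: eqP.
Qed.

End FareyRuns.

(** * Comparison of the two combinatorial structures *)

Lemma canon_pt_inj (R : realFieldType) (n : nat) (l l' : nat * nat) : (0 < n)%N ->
  (l.1 < n)%N -> (l'.1 < n)%N -> canon_pt R n n l = canon_pt R n n l' -> l = l'.
Proof.
move=> n0 ln l'n.
have cptE (m : nat * nat) : (m.1 < n)%N ->
    canon_pt R n n m = bary_pt n n (fun i => (i == m.1)%:R) m.2%:R.
  move=> mn; rewrite bary_ptE (bigD1 (Ordinal mn)) //= eqxx scale1r big1 ?addr0 // => i im.
  rewrite (_ : (i == m.1 :> nat) = false) ?scale0r //; apply/eqP => E.
  by case/eqP: im; apply: val_inj.
have sum1 (m : nat * nat) : (m.1 < n)%N -> \sum_(i < n) ((i == m.1 :> nat)%:R : R) = 1.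
  move=> mn; rewrite (bigD1 (Ordinal mn)) //= eqxx big1 ?addr0 // => i im.
  rewrite (_ : (i == m.1 :> nat) = false) //; apply/eqP => E.
  by case/eqP: im; apply: val_inj.
rewrite !cptE // => /(bary_pt_inj (leqnn n) n0)[|/eqP t0 b0]; first by rewrite !sum1.
rewrite eqr_nat in t0; have := b0 l.1 ln; rewrite eqxx.
case: (eqVneq l.1 l'.1) => [E _|_ /eqP]; last by rewrite oner_eq0.
by rewrite [l]surjective_pairing E (eqP t0) -surjective_pairing.
Qed.

Lemma nth_map_fset (T U : choiceType) (g : T -> U) (ss : seq {fset T}) p :
  nth fset0 [seq g @` s | s <- ss] p = g @` nth fset0 ss p.
Proof. by elim: ss p => [|s ss IH] [|p] //=; rewrite imfset0. Qed.

Lemma mem_map_fset (T U : choiceType) (g : {fset T} -> {fset U})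
    (ss : seq {fset T}) (u : {fset U}) :
  u \in [seq g s | s <- ss] <-> exists2 s, s \in ss & u = g s.
Proof. by split=> /mapP. Qed.

(** The map sends the t-th point of a mast to the t-th vertex with the same
    index. On both sides the vertices are determined by these labels, and both
    lists of simplices are images of the same list of label sets. All the
    simplices are non-degenerate, so dimensions of faces are numbers of
    vertices. *)
Lemma stair_flag_combinatorics (R : realFieldType) (n : nat) alpha : (1 < n)%N ->
  readable n alpha ->
  same_combinatorics (stair_flag R n (cf_blocks n alpha)) alpha.
Proof.
move=> n2 /readable_blocks[_ [w [bs' Ebs]] proper srt].
set bs := cf_blocks n alpha in Ebs proper srt *; set F := stair_flag R n bs.
pose ms := moves bs; pose M := final_height (fun=> 0%N) ms.
have n0 : (0 < n)%N := ltnW n2.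
have pm : proper_moves (iota 0 n) ms.
  by apply: proper_moves_blocks proper _ srt; rewrite Ebs.
have [phi [old run inj free]] := farey_run_history pm (fun i iA => iA) (stretched_init n).
have fareyE : farey_simplices n alpha =
    [seq (fun l => phi l.1 l.2) @` s | s <- label_run (fun=> 0%N) ms].
  by rewrite -run /farey_simplices farey_moves.
have firstE : first_prism F = stair R n n [seq index c (iota 0 n) | c <- w].
  by rewrite /first_prism stage_stair_flag Ebs //= size_iota.
have pointE l : (l.1 < n)%N -> point (first_prism F) l = canon_pt R n n l.
  by move=> ln; rewrite firstE; apply: point_canonical.
have heightE i : mast_height F i = M i := mast_height_moves R i proper.
have labelP s l : s \in label_run (fun=> 0%N) ms -> l \in s ->
    (l.1 < n)%N /\ (l.2 <= M l.1)%N.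
  move=> sm ls; have [+ le] := label_run_mem pm sm ls.
  by rewrite mem_iota /= add0n.
have simplicesE : flag_simplices F = [seq canon_pt R n n @` s | s <- label_run (fun=> 0%N) ms].
  rewrite /flag_simplices concat_labels_moves // -/ms.
  apply: (proj1 (eq_in_map _ _ (label_run (fun=> 0%N) ms))) => s sm.
  by apply: eq_in_imfset => // l ls; apply: pointE; have [] := labelP s l sm ls.
have vertexP x : flag_vertex F x <->
    exists l, [/\ (l.1 < n)%N, (l.2 <= M l.1)%N & x = canon_pt R n n l].
  have sb : size (base (first_prism F)) = n by rewrite firstE /= size_canon_base.
  split=> [[i [t []]]|[[i t] /= [ik tM ->]]].
    by rewrite sb heightE => ik tM ->; exists (i, t); rewrite pointE.
  by exists i, t; rewrite sb heightE pointE.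
have Mb i : (M i <= size ms)%N.
  by rewrite /M /final_height add0n -(size_map (fun m => m.2) ms) count_size.
pose f (x : 'rV[R]_n) := if [pick l : 'I_n * 'I_(size ms).+1 |
    x == canon_pt R n n (nat_of_ord l.1, nat_of_ord l.2)] is Some l
  then phi l.1 l.2 else 0.
have fE l : (l.1 < n)%N -> (l.2 <= M l.1)%N -> f (canon_pt R n n l) = phi l.1 l.2.
  move=> ln lM; rewrite /f; case: pickP => [l' /eqP /canon_pt_inj E|no].
    by rewrite E //= n0.
  have lb : (l.2 < (size ms).+1)%N by rewrite ltnS (leq_trans lM).
  by have := no (Ordinal ln, Ordinal lb); rewrite /= -surjective_pairing eqxx.
have f_inj x y : flag_vertex F x -> flag_vertex F y -> f x = f y -> x = y.
  move=> /vertexP[[i t] /= [ik tM ->]] /vertexP[[j u] /= [jk uM ->]].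
  by rewrite !fE //= => /(inj i t j u ik jk tM uM) ->.
have deckE i : unit_vec n R i = canon_pt R n n (i, 0%N).
  by rewrite /canon_pt scale0r addr0.
have deckP i : (i < n)%N -> f (unit_vec n R i) = unit_vec n int i.
  by move=> ik; rewrite deckE fE //= old.
have imageE s : s \in label_run (fun=> 0%N) ms ->
    f @` (canon_pt R n n @` s) = (fun l => phi l.1 l.2) @` s.
  move=> sm; rewrite -imfset_comp; apply: eq_in_imfset => // l ls /=.
  by have [ln lM] := labelP s l sm ls; rewrite fE.
have mapE : [seq f @` s | s <- flag_simplices F] = farey_simplices n alpha.
  by rewrite simplicesE fareyE -map_comp;
     apply: (proj1 (eq_in_map _ _ (label_run (fun=> 0%N) ms))) => s /imageE.
have vertex_of s x : s \in flag_simplices F -> x \in s -> flag_vertex F x.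
  rewrite simplicesE => /mem_map_fset[S Sm ->] /imfsetP[l /= lS ->].
  by have [ln lM] := labelP S l Sm lS; apply/vertexP; exists l.
exists f; split=> //.
- split=> // z; split.
    case=> [[i ik ->]|[s + zs]].
      exists (unit_vec n R i); last exact: deckP.
      by apply/vertexP; exists (i, 0%N); rewrite deckE.
    rewrite -mapE => /mem_map_fset[S SF Es]; move: zs; rewrite Es => /imfsetP[x /= xS ->].
    by exists x => //; exact: vertex_of xS.
  case=> x /vertexP[[i t] /= [ik tM ->]] <-; rewrite fE //=.
  have [->|t0] := posnP t; first by left; exists i => //; rewrite old.
  have [s sm ts] := label_run_cover t0 tM.
  right; exists ((fun l => phi l.1 l.2) @` s).
    by rewrite fareyE; apply/mem_map_fset; exists s.
  by apply/imfsetP; exists (i, t).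
- move=> s A sF As; have := sF; rewrite simplicesE => /mem_map_fset[S Sm Es].
  have injA : {in A &, injective f}.
    by move=> x y /(fsubsetP As) xs /(fsubsetP As) ys; apply: f_inj; exact: vertex_of sF _.
  have freeR : aff_free (fun x : 'rV[R]_n => x) A.
    apply: aff_free_sub As _; rewrite Es; apply: aff_free_imfset.
      move=> l l' /(labelP _ _ Sm)[ln _] /(labelP _ _ Sm)[l'n _].
      exact: canon_pt_inj.
    have [B [c [H [-> sB cB]]]] := label_run_slab pm Sm.
    exact: slab_aff_free.
  have freeZ : aff_free (fun y : 'rV[int]_n => map_mx intr y : 'rV[R]_n) (f @` A).
    apply: (aff_free_sub (s := f @` s)).
      by apply/fsubsetP => y /imfsetP[x /= xA ->]; apply: in_imfset; exact: (fsubsetP As).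
    rewrite Es imageE //; apply: aff_free_imfset; last exact: free.
    move=> l l' /(labelP _ _ Sm)[ln lM] /(labelP _ _ Sm)[l'n l'M] E.
    by have := inj _ _ _ _ ln l'n lM l'M E; rewrite -!surjective_pairing.
  rewrite (aff_dim_free freeZ) card_in_imfset //=.
  by have := aff_dim_free freeR; rewrite map_id.
- move=> p A Av; rewrite -mapE nth_map_fset.
  apply/fsubsetP/fsubsetP => [sub y /imfsetP[x /= xA ->]|sub x xA].
    by apply: in_imfset; exact: sub.
  have /imfsetP[y /= ys E] := sub (f x) (in_imfset _ _ xA).
  rewrite (f_inj x y (Av x xA) _ E) //.
  case: (ltnP p (size (flag_simplices F))) => lt; last by rewrite nth_default in ys.
  by apply: vertex_of ys; exact: mem_nth.
Qed.

Theorem theorem3p27 (R : realFieldType) (n : nat) (hn : (1 < n)%N) :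
  [/\ (* T(alpha) is well defined *)
      forall alpha : seq cf_symbol, extended_cf n alpha ->
        exists! F : flag R n, is_T alpha F,
      (* it is a canonical prismatic flag diagram with n - 1 stages *)
      forall (alpha : seq cf_symbol) (F : flag R n),
        extended_cf n alpha -> is_T alpha F ->
        canonical_flag_diagram F /\ size F = n.-1,
      (* it is a complete invariant *)
      forall (alpha beta : seq cf_symbol) (F G : flag R n),
        extended_cf n alpha -> extended_cf n beta ->
        is_T alpha F -> is_T beta G ->
        (alpha = beta <-> F = G)
    & (* it has the combinatorics of the Farey polyhedron *)
      forall (alpha : seq cf_symbol) (F : flag R n),
        extended_cf n alpha -> is_T alpha F ->
        same_combinatorics F alpha].
Proof.
split=> [alpha|alpha F|alpha beta F G|alpha F].
- move=> /extended_readable ra; exists (stair_flag R n (cf_blocks n alpha)).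
  by split=> [|F /(is_TP F ra) -> //]; apply/is_TP.
- by move=> /extended_readable ra /(is_TP F ra) ->; exact: stair_flag_canonical.
- move=> /extended_readable ra /extended_readable rb /(is_TP F ra) -> /(is_TP G rb) ->.
  by split=> [->//|]; exact: stair_flag_inj.
- by move=> /extended_readable ra /(is_TP F ra) ->; exact: stair_flag_combinatorics.
Qed.
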